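(* Let $Q\in\mathcal B$. Suppose $Z$ is $\Lambda$-essentially bounded away from zero. Then the function $(0,1)\ni x\mapsto\mathcal H_x(\Lambda,\phi_0)(Q)$ is left and right differentiable, and $$\left.\frac{d}{dx}\mathcal H_x(\Lambda,\phi_0)(Q)\right|_{x=\alpha}=\mathcal D^{\alpha,\alpha}_1(Q)=\mathcal E^{\alpha,\alpha}_1(Q)$$ for all except at most countably many $\alpha\in(0,1)$.
   Context: Setting. Let $X$ be a set, $S:X\to X$ a bijection, $\mathcal A$ a $\sigma$-algebra on $X$, $\mathcal A_0$ the $\sigma$-algebra generated by $\bigcup_{i\ge 0}S^{-i}\mathcal A$, $\mathcal B$ the $\sigma$-algebra generated by $\bigcup_{i\in\mathbb Z}S^{-i}\mathcal A$, and $\mathcal A_m:=S^{-m}\mathcal A_0=\{S^{-m}A:A\in\mathcal A_0\}$ for integers $m\le 0$ (so $\mathcal A_0\subset\mathcal A_{-1}\subset\cdots$). Let $\phi_0$ be a finite positive measure on $\mathcal A_0$, and $\Lambda$ a finite positive measure on $\mathcal A_0$ with $\Lambda\circ S^{-1}=\Lambda$ and $\Lambda\ll\phi_0$; let $Z\ge0$ be an $\mathcal A_0$-measurable version of $d\Lambda/d\phi_0$. For $Q\subset X$ let $\mathcal C(Q)$ be the set of all sequences $(A_m)_{m\le0}$ with $A_m\in\mathcal A_m$ for all $m\le 0$ and $Q\subset\bigcup_{m\le0}A_m$. The symbol $\Lambda$ also denotes $\Lambda(Q):=\inf_{(A_m)\in\mathcal C(Q)}\sum_{m\le0}\Lambda(S^mA_m)$,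 $Q\subset X$; its restriction to $\mathcal B$ is the unique $S$-invariant measure on $\mathcal B$ extending $\Lambda$. Conventions: extended real numbers are used, $0\log0:=0$, $y^x:=e^{x\log y}$ and thus $0^0:=1$; $Z^\alpha\log Z:=0$ where $Z=0$ ($\alpha>0$). ''$Z$ is $\Lambda$-essentially bounded away from zero'' means that there is $c>0$ with $Z\ge c$ $\Lambda$-a.e. For $\alpha\ge0$ and $Q\subset X$: $\mathcal H_\alpha(\Lambda,\phi_0)(Q):=\inf_{(A_m)\in\mathcal C(Q)}\sum_{m\le0}\int_{S^mA_m}Z^\alpha d\phi_0$. For $\epsilon>0$ and $0\le\beta\le1$: $\mathcal C^1_\epsilon(Q):=\{(A_m)\in\mathcal C(Q):\sum_{m\le0}\Lambda(S^mA_m)<\Lambda(Q)+\epsilon\}$; $\mathcal H^{\beta,1}(\Lambda,\phi_0)(Q):=\lim_{\epsilon\to0}\inf_{(A_m)\in\mathcal C^1_\epsilon(Q)}\sum_{m\le0}\int_{S^mA_m}Z^\beta d\phi_0$; $\mathcal C^{\beta,1}_\epsilon(Q):=\{(A_m)\in\mathcal C^1_\epsilon(Q):\sum_{m\le0}\int_{S^mA_m}Z^\beta d\phi_0<\mathcal H^{\beta,1}(\Lambda,\phi_0)(Q)+\epsilon\}$. For $0<\alpha\le1$ and $0\le\beta\le1$: $\mathcal D^{\alpha,\beta}_1(Q):=\lim_{\epsilon\to0}\inf_{(A_m)\in\mathcal C^{\beta,1}_\epsilon(Q)}\sum_{m\le0}\int_{S^mA_m}Z^\alpha\log Z\,d\phi_0$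 and $\mathcal E^{\alpha,\beta}_1(Q):=\lim_{\epsilon\to0}\sup_{(A_m)\in\mathcal C^{\beta,1}_\epsilon(Q)}\sum_{m\le0}\int_{S^mA_m}Z^\alpha\log Z\,d\phi_0$. *)

(* Defs.v *)
From mathcomp Require Import all_boot all_order all_algebra.
From mathcomp Require Import all_classical all_reals all_analysis.
From mathcomp Require Import measurable_realfun.
Set Implicit Arguments.
Unset Strict Implicit.
Unset Printing Implicit Defensive.
Import Order.TTheory GRing.Theory Num.Theory.
Import numFieldNormedType.Exports.
Local Open Scope classical_set_scope.
Local Open Scope ring_scope.
Local Open Scope ereal_scope.

Section sigma_algebras.
Context {X : pointedType}.
Variables (S : X -> X) (cA : set (set X)).

Definition forward_gen : set (set X) :=
  \bigcup_i [set iter i S @^-1` A | A in cA].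

(* S is meant to be bijective, so that [iter i S @` A] is the preimage of A
   under the i-th power of the inverse of S. *)
Definition twosided_gen : set (set X) :=
  forward_gen `|` \bigcup_i [set iter i S @` A | A in cA].

(* The sigma-algebra A_m = S^{-m} A_0 for m = -n <= 0; below, every family
   indexed by the integers m <= 0 is indexed by n = -m : nat. *)
Definition A_neg (n : nat) : set (set X) :=
  [set iter n S @` A | A in <<s forward_gen >>].

Definition Ccover (Q : set X) : set (nat -> set X) :=
  [set A | (forall n, A_neg n (A n)) /\ Q `<=` \bigcup_n A n].

End sigma_algebras.

(* X equipped with the sigma-algebra A_0. *)
Notation A0_type S cA := (g_sigma_algebraType (forward_gen S cA)).

(* sum_{m <= 0} c (S^m A_m); S^m A_m with m = -n is a preimage. *)
Definition cover_sum {X : Type} {R : realType} (S : X -> X)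
    (c : set X -> \bar R) (A : nat -> set X) : \bar R :=
  \sum_(n <oo) c (iter n S @^-1` A n).

Section relative_entropy_measures.
Context {X : pointedType} {R : realType} (S : X -> X) (cA : set (set X)).
Variables (phi0 Lambda : {finite_measure set (A0_type S cA) -> \bar R}).
Variable Z : A0_type S cA -> \bar R.

Definition outer_Lambda (Q : set X) : \bar R :=
  ereal_inf [set cover_sum S Lambda A | A in Ccover S cA Q].

(* [poweR] satisfies 0 `^ 0 = 1 and 0 `^ a = 0 for a <> 0. *)
Definition int_pow (a : R) (B : set X) : \bar R :=
  \int[phi0]_(x in (B : set (A0_type S cA))) (Z x `^ a).

(* Where Z = 0 and a > 0 the integrand is 0 * -oo = 0. *)
Definition int_pow_log (a : R) (B : set X) : \bar R :=
  \int[phi0]_(x in (B : set (A0_type S cA))) (Z x `^ a * lne (Z x)).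

Definition calH (a : R) (Q : set X) : \bar R :=
  ereal_inf [set cover_sum S (int_pow a) A | A in Ccover S cA Q].

Definition Ccover1 (e : R) (Q : set X) : set (nat -> set X) :=
  [set A | Ccover S cA Q A /\ cover_sum S Lambda A < outer_Lambda Q + e%:E].

Definition calH1 (b : R) (Q : set X) : \bar R :=
  lim (ereal_inf [set cover_sum S (int_pow b) A | A in Ccover1 e Q]
       @[e --> 0^'+]).

Definition Ccoverb1 (b e : R) (Q : set X) : set (nat -> set X) :=
  [set A | Ccover1 e Q A /\ cover_sum S (int_pow b) A < calH1 b Q + e%:E].

(* [cover_sum] is here a series of terms of arbitrary sign, understood as the
   limit of its partial sums. If Z is Lambda-essentially bounded away from 0,
   0 < a < 1 and 0 < b <= 1, then |Z^a log Z| <= C Z phi0-a.e., so the series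
   is absolutely convergent on [Ccoverb1 b e Q]. *)
Definition calD1 (a b : R) (Q : set X) : \bar R :=
  lim (ereal_inf [set cover_sum S (int_pow_log a) A | A in Ccoverb1 b e Q]
       @[e --> 0^'+]).

Definition calE1 (a b : R) (Q : set X) : \bar R :=
  lim (ereal_sup [set cover_sum S (int_pow_log a) A | A in Ccoverb1 b e Q]
       @[e --> 0^'+]).

Definition essentially_bounded_away_from_zero : Prop :=
  exists2 c : R, (0 < c)%R & {ae Lambda, forall x, c%:E <= Z x}.

End relative_entropy_measures.

Definition left_differentiable {R : realType} (f : R -> R) (x : R) : Prop :=
  cvg ((f (x + t) - f x)%R / t @[t --> 0^'-])%R.

Definition right_differentiable {R : realType} (f : R -> R) (x : R) : Prop :=
  cvg ((f (x + t) - f x)%R / t @[t --> 0^'+])%R.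

(* Main.v *)
Require Import Defs.
From mathcomp Require Import all_boot all_order all_algebra.
From mathcomp Require Import all_classical all_reals all_analysis.
From mathcomp Require Import measurable_realfun.
From mathcomp Require Import ring lra.
Set Implicit Arguments.
Unset Strict Implicit.
Unset Printing Implicit Defensive.
Import Order.TTheory GRing.Theory Num.Theory.
Import numFieldNormedType.Exports.
Local Open Scope classical_set_scope.
Local Open Scope ring_scope.

(** Put [y := 1 / Z] and [u := inf_j y o S^j], which is [Lambda]-almost
    everywhere [S]-invariant because [u <= u o S] and both have the same
    integral.  In terms of [B_n := S^-n A_n] the cost of a cover for [calH a] is
    [sum_n int_(B_n) y^(1-a) dLambda].  It is at least the cost for the density
    [u^(1-a)], and conversely a cover can be modified, by letting every point
    wait until [y] is close to its infimum along the orbit, so that the first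
    cost falls to about the second.  For invariant densities two covers have a
    common refinement which is no more expensive than either of them, so every
    cover that is nearly optimal for [Lambda] is nearly optimal for all bounded
    invariant densities at once.  Hence [calH a] is the limit of the costs for
    [u^(1-a)] along nearly [Lambda]-optimal covers, and since [s^(1-a)] has a
    Taylor expansion in [a] which is uniform for [0 <= s <= 1/c], [calH] is
    differentiable at every point of (0,1): the exceptional set is empty.  The
    same expansion, applied to [y] on covers which are nearly optimal for both
    costs, squeezes [calD1] and [calE1] to the derivative. *)

(** * Integrals of bounded densities *)

Section bounded_functions.
Context d (T : measurableType d) (R : realType).
Variable L : {finite_measure set T -> \bar R}.
Implicit Types (f g : T -> R) (A B : set T).

Definition bounded_mfun f :=
  measurable_fun setT f /\ exists M : R, forall x, `|f x| <= M.

Lemma bounded_mfun_integrable f A : bounded_mfun f -> measurable A ->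
  L.-integrable A (EFin \o f).
Proof.
move=> [mf [M fM]] mA; apply: measurable_bounded_integrable => //.
- by rewrite -ge0_fin_numE// fin_num_measure.
- exact: measurable_funTS.
- exists M; split; first by rewrite num_real.
  by move=> N MN x _ /=; rewrite (le_trans (fM x))// ltW.
Qed.
Hint Resolve bounded_mfun_integrable : core.

Lemma bounded_mfun_cst (r : R) : bounded_mfun (cst r).
Proof. by split; [exact: measurable_cst | exists `|r|]. Qed.

Lemma bounded_mfunD f g : bounded_mfun f -> bounded_mfun g ->
  bounded_mfun (fun x => f x + g x).
Proof.
move=> [mf [M fM]] [mg [N gN]]; split; first exact: measurable_funD.
by exists (M + N) => x; rewrite (le_trans (ler_normD _ _))// lerD.
Qed.

Lemma bounded_mfunZ (r : R) f : bounded_mfun f -> bounded_mfun (fun x => r * f x).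
Proof.
move=> [mf [M fM]]; split; first exact: measurable_funM.
by exists (`|r| * M) => x; rewrite normrM ler_wpM2l.
Qed.

Definition lam f B : R := \int[L]_(x in B) f x.

Lemma lamE f B : bounded_mfun f -> measurable B ->
  (lam f B)%:E = (\int[L]_(x in B) (f x)%:E)%E.
Proof.
move=> bf mB; rewrite /lam /Rintegral fineK//.
exact/integrable_fin_num/bounded_mfun_integrable.
Qed.

Lemma lamU f A B : bounded_mfun f -> measurable A -> measurable B ->
  A `&` B = set0 -> lam f (A `|` B) = lam f A + lam f B.
Proof.
move=> bf mA mB AB; apply: Rintegral_setU => //; last exact/disj_set2P.
by apply: bounded_mfun_integrable => //; exact: measurableU.
Qed.

Lemma lam_split f A B : bounded_mfun f -> measurable A -> measurable B ->
  lam f A = lam f (A `&` B) + lam f (A `\` B).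
Proof.
move=> bf mA mB; rewrite -lamU ?setUIDK//; first exact: measurableI.
  exact: measurableD.
by apply/seteqP; split=> x //= [[_ ?] []].
Qed.

Lemma lam_ge0 f B : (forall x, 0 <= f x) -> 0 <= lam f B.
Proof. by move=> f0; apply: Rintegral_ge0. Qed.

Lemma le_lam f g B : bounded_mfun f -> bounded_mfun g -> measurable B ->
  (forall x, B x -> f x <= g x) -> lam f B <= lam g B.
Proof. by move=> bf bg mB fg; apply: le_Rintegral; auto. Qed.

Lemma lam_sub f A B : bounded_mfun f -> (forall x, 0 <= f x) ->
  measurable A -> measurable B -> A `<=` B -> lam f A <= lam f B.
Proof.
move=> bf f0 mA mB AB; rewrite (lam_split bf mB mA) (_ : B `&` A = A).
  by rewrite lerDl lam_ge0.
by apply/setIidr.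
Qed.

Lemma lam_subU f A B : bounded_mfun f -> (forall x, 0 <= f x) ->
  measurable A -> measurable B -> lam f (A `|` B) <= lam f A + lam f B.
Proof.
move=> bf f0 mA mB; have mAB : measurable (A `|` B) by exact: measurableU.
rewrite (lam_split bf mAB mA) lerD//; apply: lam_sub => //.
- exact: measurableI.
- exact: measurableD.
- by move=> x [[]].
Qed.

Lemma lamD f g B : bounded_mfun f -> bounded_mfun g -> measurable B ->
  lam (fun x => f x + g x) B = lam f B + lam g B.
Proof. by move=> bf bg mB; apply: RintegralD; auto. Qed.

Lemma lamZ (r : R) f B : bounded_mfun f -> measurable B ->
  lam (fun x => r * f x) B = r * lam f B.
Proof. by move=> bf mB; apply: RintegralZl; auto. Qed.

Lemma lam1 B : measurable B -> (lam (cst 1) B)%:E = L B.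
Proof. by move=> mB; rewrite /lam Rintegral_cst// mul1r fineK// fin_num_measure. Qed.

End bounded_functions.

(** * Covers and stopping *)

Section covers.
Context d (T : measurableType d) (R : realType).
Variables (L : {finite_measure set T -> \bar R}) (S Si : T -> T).
Hypotheses (mS : measurable_fun setT S) (SiK : cancel Si S).
Implicit Types (f : T -> R) (A Q : set T) (B G : nat -> set T).

Definition invariant_density f :=
  forall A, measurable A -> lam L f (S @^-1` A) = lam L f A.

(* A set [A_n] of level [n] is encoded by [B_n], its preimage under the n-th
   power of [S]; thus [x \in A_n] iff [B_n] contains the n-th iterate of the
   inverse [Si] at [x]. *)
Definition is_cover Q B := (forall n, measurable (B n)) /\
  forall x, Q x -> exists n, B n (iter n Si x).

(* A point covered at level [n] is kept until the first level [m >= n] at which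
   [G m] allows it to be stopped: [pending B G n] consists of the points present
   at level [n], before those in [G n] are stopped. *)
Fixpoint pending B G n : set T :=
  if n is m.+1 then S @^-1` (pending B G m `\` G m) `|` B m.+1 else B 0%N.

Definition stopped B G n := pending B G n `&` G n.

Definition psum f B N : R := \sum_(0 <= n < N) lam L f (B n).

Lemma psumS f B N : psum f B N.+1 = psum f B N + lam L f (B N).
Proof. by rewrite /psum big_nat_recr. Qed.

Lemma measurable_preimS A : measurable A -> measurable (S @^-1` A).
Proof. by move=> mA; rewrite -[_ @^-1` _]setTI; exact: mS. Qed.

Lemma measurable_pending B G n : (forall n, measurable (B n)) ->
  (forall n, measurable (G n)) -> measurable (pending B G n).
Proof.
move=> mB mG; elim: n => //= n IH; apply: measurableU => //.
by apply: measurable_preimS; exact: measurableD.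
Qed.

Lemma measurable_stopped B G n : (forall n, measurable (B n)) ->
  (forall n, measurable (G n)) -> measurable (stopped B G n).
Proof. by move=> mB mG; apply: measurableI => //; exact: measurable_pending. Qed.

Lemma psum_ge0 f B N : (forall x, 0 <= f x) -> 0 <= psum f B N.
Proof. by move=> f0; apply: sumr_ge0 => n _; apply: lam_ge0. Qed.

(** A balance of mass: by invariance, passing the unstopped points to the next level preserves their
    [f]-mass, and newly covered points add at most their own. Overlaps lose mass, hence an
    inequality. *)
Lemma lam_pendingD_psum f B G N : bounded_mfun f -> (forall x, 0 <= f x) ->
  invariant_density f -> (forall n, measurable (B n)) ->
  (forall n, measurable (G n)) ->
  lam L f (pending B G N) + psum f (stopped B G) N <= psum f B N.+1.
Proof.
move=> bf f0 fS mB mG; elim: N => [|N IH].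
  by rewrite /psum big_nil big_nat1 addr0.
have mP := measurable_pending N mB mG.
have mD : measurable (pending B G N `\` G N) by exact: measurableD.
rewrite /psum big_nat_recr//= [leRHS]big_nat_recr//= -/(psum _ _ _) -/(psum _ _ _).
have := lam_subU L bf f0 (measurable_preimS mD) (mB N.+1).
rewrite fS// => h; rewrite (lam_split _ bf mP (mG N)) in IH.
rewrite /stopped; lra.
Qed.

Lemma psum_stopped f B G N : bounded_mfun f -> (forall x, 0 <= f x) ->
  invariant_density f -> (forall n, measurable (B n)) ->
  (forall n, measurable (G n)) ->
  psum f (stopped B G) N <= psum f B N.
Proof.
move=> bf f0 fS mB mG; case: N => [|N]; first by rewrite /psum !big_nil.
apply: le_trans (lam_pendingD_psum N bf f0 fS mB mG).
rewrite {1}/psum big_nat_recr//= addrC lerD2r lam_sub//.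
- exact: measurable_stopped.
- exact: measurable_pending.
- by move=> x [].
Qed.

(** A pending point is either stopped at once or pending at the next level, and from level [N] on
    everything is stopped; the induction is on the number of levels left before [N]. *)
Lemma stopped_cover Q B G N : is_cover Q B -> (forall n, measurable (G n)) ->
  (forall n, (N <= n)%N -> G n = setT) -> is_cover Q (stopped B G).
Proof.
move=> [mB QB] mG GT; split; first by move=> n; exact: measurable_stopped.
move=> x /QB[n Bn].
have : pending B G n (iter n Si x) by case: n Bn => //= n Bn; right.
have [k] := ubnP (N - n)%N; elim: k n {Bn} => // k IH n Nnk Pn.
have [Gn|Gn] := pselect (G n (iter n Si x)); first by exists n.
apply: (IH n.+1).
  case: (ltnP n N) => [nN|Nn]; last by exfalso; apply: Gn; rewrite GT.
  by rewrite -ltnS (leq_trans _ Nnk)// ltnS -subSn// subSS leqnn.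
by left => /=; rewrite SiK.
Qed.

Lemma pending_iter B n k x : pending B (fun=> set0) n (iter n Si x) ->
  pending B (fun=> set0) (k + n) (iter (k + n) Si x).
Proof.
move=> Pn; elim: k => //= k IH; left => /=.
by rewrite SiK; split.
Qed.

(** Each point is placed at the first level by which both covers have reached it. The mass placed up
    to level [N] is then that of the points reached by both, which neither cover can have paid less
    for. *)
Lemma common_refinement Q B B' : is_cover Q B -> is_cover Q B' ->
  exists E, is_cover Q E /\ forall f, bounded_mfun f -> (forall x, 0 <= f x) ->
    invariant_density f ->
    forall N, psum f E N <= psum f B N /\ psum f E N <= psum f B' N.
Proof.
move=> [mB QB] [mB' QB'].
pose P B := pending B (fun=> set0).
have mP B0 n : (forall n, measurable (B0 n)) -> measurable (P B0 n).
  by move=> mB0; apply: measurable_pending.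
(* With nothing ever stopped, [P B n] holds all points reached by level [n]. Hence the preimage of
   [PI m] lies in [PI m.+1]; [E] collects the increments, and their masses telescope to that of
   [PI N]. *)
pose PI n := P B n `&` P B' n.
have mPI n : measurable (PI n) by apply: measurableI; exact: mP.
pose E n := if n is m.+1 then PI n `\` S @^-1` (PI m) else PI 0%N.
have mE n : measurable (E n).
  by case: n => //= n; apply: measurableD => //; exact: measurable_preimS.
exists E; split.
  split=> // x Qx.
  have exPI : exists n, `[< PI n (iter n Si x) >].
    have [n Bn] := QB _ Qx; have [m Bm] := QB' _ Qx.
    exists (m + n)%N; apply/asboolP; split.
      by apply: pending_iter; case: n Bn => //= n Bn; right.
    by rewrite addnC; apply: pending_iter; case: m Bm => //= m Bm; right.
  case: (ex_minnP exPI) => n /asboolP PIn nmin; exists n.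
  case: n PIn nmin => //= n PIn nmin; split=> //= PIn'.
  rewrite SiK in PIn'.
  by have := nmin _ (asboolT PIn'); rewrite ltnn.
move=> f bf f0 fS.
have EPI N : psum f E N.+1 = lam L f (PI N).
  elim: N => [|N IH]; first by rewrite /psum big_nat1.
  rewrite /psum big_nat_recr//= -/(psum _ _ _) IH -fS//.
  rewrite [RHS](lam_split _ bf (mPI _) (measurable_preimS (mPI N))).
  congr (lam L f _ + _); apply/esym/setIidr => y [/= y1 y2].
  by split; left => /=; split.
have PB B0 N : (forall n, measurable (B0 n)) -> lam L f (P B0 N) <= psum f B0 N.+1.
  move=> mB0; have m0 (n : nat) : measurable (@set0 T) by [].
  by apply: le_trans (lam_pendingD_psum N bf f0 fS mB0 m0); rewrite lerDl psum_ge0.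
case=> [|N]; first by rewrite /psum !big_nil.
rewrite EPI; split; (apply: le_trans (PB _ _ _); last by []); apply: lam_sub => //;
  try exact: mP; by move=> y [].
Qed.

End covers.

(** * Infimum of a function along forward orbits and its almost everywhere invariance *)

Section orbit_infimum.
Context d (T : measurableType d) (R : realType).
Variables (L : {finite_measure set T -> \bar R}) (S : T -> T).
Hypothesis mS : measurable_fun setT S.
Hypothesis LS : forall A, measurable A -> L (S @^-1` A) = L A.

Lemma lam_comp (f : T -> R) A : bounded_mfun f -> measurable A ->
  lam L (f \o S) (S @^-1` A) = lam L f A.
Proof.
move=> bf mA; have [mf [M fM]] := bf.
have bfS : bounded_mfun (f \o S).
  by split; [exact: measurableT_comp | exists M => x /=].
have mSA := measurable_preimS mS mA.
congr fine.
rewrite -(integral_pushforward mS (f := EFin \o f))//.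
- by apply: eq_measure_integral => B mB _; exact: LS.
- exact: measurableT_comp.
- exact: (bounded_mfun_integrable L bfS).
Qed.

Variables (y : T -> R) (C : R).
Hypotheses (my : measurable_fun setT y) (y_ge0 : forall x, 0 <= y x)
  (y_leC : forall x, y x <= C).

Definition orbit_inf x : R := inf (range (fun j => y (iter j S x))).

Let has_lb x : has_lbound (range (fun j => y (iter j S x))).
Proof. by exists 0 => _ [j _ <-]. Qed.

Lemma orbit_inf_le x j : orbit_inf x <= y (iter j S x).
Proof. by apply: ge_inf => //; exists j. Qed.

Lemma le_orbit_inf x r : (forall j, r <= y (iter j S x)) -> r <= orbit_inf x.
Proof.
move=> ry; apply: lb_le_inf; first by exists (y x), 0%N.
by move=> _ [j _ <-].
Qed.

Lemma orbit_inf_ge0 x : 0 <= orbit_inf x.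
Proof. exact: le_orbit_inf. Qed.

Lemma orbit_inf_leC x : orbit_inf x <= C.
Proof. exact: le_trans (orbit_inf_le x 0) _. Qed.

Lemma orbit_inf_leS x : orbit_inf x <= orbit_inf (S x).
Proof. by apply: le_orbit_inf => j; rewrite -iterSr; exact: orbit_inf_le. Qed.

Lemma orbit_inf_le_iter x j : orbit_inf x <= orbit_inf (iter j S x).
Proof. by elim: j => //= j /le_trans; apply; exact: orbit_inf_leS. Qed.

Lemma measurable_iter j : measurable_fun setT (iter j S).
Proof.
elim: j => [|j IH]; first exact: measurable_id.
exact: (measurableT_comp mS IH).
Qed.

Lemma measurable_orbit_inf : measurable_fun setT orbit_inf.
Proof.
rewrite (_ : orbit_inf = fun x => infs (fun j => y (iter j S x)) 0).
  apply: measurable_fun_infs => // j.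
  exact: (measurableT_comp my (measurable_iter j)).
by apply/funext => x; rewrite /infs /sdrop /orbit_inf; congr inf;
  apply/seteqP; split => _ [j _ <-]; exists j.
Qed.

Lemma bounded_orbit_inf : bounded_mfun orbit_inf.
Proof.
split; first exact: measurable_orbit_inf.
by exists C => x; rewrite ger0_norm ?orbit_inf_leC ?orbit_inf_ge0.
Qed.

Lemma orbit_inf_ae_invariant : ae_eq L setT (orbit_inf \o S) orbit_inf.
Proof.
have bu := bounded_orbit_inf; have mu := measurable_orbit_inf.
have muS : measurable_fun setT (orbit_inf \o S) by exact: measurableT_comp.
have buS : bounded_mfun (orbit_inf \o S).
  by case: bu => _ [M uM]; split => //; exists M => x /=.
have mD : measurable_fun setT (fun x => orbit_inf (S x) + (-1) * orbit_inf x).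
  by apply: measurable_funD => //; exact: measurable_funM.
have bD := bounded_mfunD buS (bounded_mfunZ (-1) bu).
have int0 : (\int[L]_(x in setT) `|(orbit_inf (S x) + (-1) * orbit_inf x)%:E| = 0)%E.
  under eq_integral => x _.
    rewrite gee0_abs; last by rewrite lee_fin mulN1r subr_ge0 orbit_inf_leS.
    over.
  rewrite -(lamE L bD measurableT) (lamD L buS (bounded_mfunZ (-1) bu))//.
  rewrite lamZ// -[X in lam L (orbit_inf \o S) X](preimage_setT S) lam_comp//.
  by rewrite mulN1r subrr.
have /ae_eq_integral_abs := int0.
have me : measurable_fun setT (fun x => (orbit_inf (S x) + (-1) * orbit_inf x)%:E).
  exact/measurable_EFinP.
move=> /(_ measurableT me); apply: filterS => x /= /(_ I) [] /eqP.
by rewrite mulN1r subr_eq0 => /eqP.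
Qed.

(** Almost everywhere equality of [orbit_inf \o S] and [orbit_inf] survives composition with [phi];
    the rest is a change of variables. *)
Lemma invariant_comp_orbit_inf (phi : R -> R) :
  bounded_mfun (phi \o orbit_inf) ->
  invariant_density L S (phi \o orbit_inf).
Proof.
move=> bphi A mA; rewrite -[RHS]lam_comp//.
have [mphi _] := bphi; have mSA := measurable_preimS mS mA.
congr fine; apply: ae_eq_integral => //.
- by apply: measurable_funTS; exact/measurable_EFinP.
- apply: measurable_funTS; apply/measurable_EFinP.
  exact: (measurableT_comp mphi mS).
- have := orbit_inf_ae_invariant; apply: filterS => x /= /(_ I) e _.
  by rewrite e.
Qed.

End orbit_infimum.

Lemma bounded_mfun_powR d (T : measurableType d) (R : realType) (f : T -> R)
    (C p : R) : 0 <= p -> measurable_fun setT f ->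
  (forall x, 0 <= f x <= C) -> bounded_mfun (fun x => f x `^ p).
Proof.
move=> p0 mf fC; split.
  exact: (measurableT_comp (measurable_powR p) mf).
exists (C `^ p) => x; rewrite ger0_norm ?powR_ge0//.
have /andP[f0 fleC] := fC x.
by rewrite ge0_ler_powR// nnegrE// (le_trans f0).
Qed.

(** * Waiting until the density is close to its orbit infimum *)

Section stopping.
Context d (T : measurableType d) (R : realType).
Variables (L : {finite_measure set T -> \bar R}) (S Si : T -> T).
Hypotheses (mS : measurable_fun setT S) (SiK : cancel Si S).
Hypothesis LS : forall A, measurable A -> L (S @^-1` A) = L A.
Variables (y : T -> R) (C : R).
Hypotheses (my : measurable_fun setT y) (y_ge0 : forall x, 0 <= y x)
  (y_leC : forall x, y x <= C).

Local Notation u := (orbit_inf S y).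
Local Notation one := (cst (1 : R) : T -> R).

Let bone : bounded_mfun one. Proof. exact: bounded_mfun_cst. Qed.
Let one0 (x : T) : 0 <= one x. Proof. exact: ler01. Qed.

Lemma invariant_cst1 : invariant_density L S one.
Proof. by move=> A mA; exact: (lam_comp mS LS bone mA). Qed.

(** The tolerance is imposed on the [p]-th powers because these are the densities that get
    integrated. *)
Definition near_orbit_inf (p e : R) : set T := [set x | y x `^ p <= u x `^ p + e].

Lemma measurable_near_orbit_inf p e : measurable (near_orbit_inf p e).
Proof.
have mle : measurable_fun setT (fun x => y x `^ p <= u x `^ p + e).
  apply: measurable_fun_ler.
    exact: (measurableT_comp (measurable_powR p) my).
  apply: measurable_funD => //; apply: (measurableT_comp (measurable_powR p)).
  exact: (measurable_orbit_inf mS my y_ge0).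
by have := mle measurableT [set true] I; rewrite setTI.
Qed.

(* The points whose iterates 1, ..., n under [S] all avoid [G]. *)
Fixpoint avoiding (G : set T) n : set T :=
  if n is m.+1 then S @^-1` (avoiding G m `\` G) else setT.

Lemma measurable_avoiding G n : measurable G -> measurable (avoiding G n).
Proof.
move=> mG; elim: n => //= n IH.
by apply: (measurable_preimS mS); exact: measurableD.
Qed.

Lemma avoiding_iter G n x i : avoiding G n x -> (i < n)%N ->
  ~ G (iter i.+1 S x).
Proof.
elim: n x i => // n IH x [|i] /= [An Gx] //.
by rewrite ltnS => /(IH _ _ An); rewrite -iterSr.
Qed.

(** If all iterates of [S x] avoided the set, then, [u] being nondecreasing along the orbit, [y ^ p]
    would exceed [u (S x) ^ p + e] on the whole orbit of [S x], contradicting that [u (S x)] is the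
    infimum of [y] there. *)
Lemma bigcap_avoiding p e : 0 < p -> 0 < e ->
  \bigcap_n avoiding (near_orbit_inf p e) n = set0.
Proof.
move=> p0 e0; apply/seteqP; split => // x xA.
have xG i : ~ near_orbit_inf p e (iter i S (S x)).
  by rewrite -iterSr; apply: (@avoiding_iter _ i.+1) => //; exact: xA.
pose r := (u (S x) `^ p + e) `^ p^-1.
have s0 : 0 <= u (S x) `^ p + e by rewrite addr_ge0 ?powR_ge0 ?ltW.
have rp : r `^ p = u (S x) `^ p + e.
  by rewrite /r -powRrM mulVf ?gt_eqF// powRr1.
have u0 := orbit_inf_ge0 S y_ge0.
have : r <= u (S x).
  apply: le_orbit_inf => j; rewrite leNgt; apply/negP => yr; apply: (xG j).
  rewrite /near_orbit_inf/=; apply: (@le_trans _ _ (r `^ p)).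
    by apply: (ge0_ler_powR (ltW p0)); rewrite ?nnegrE ?powR_ge0// ltW.
  rewrite rp lerD2r; apply: (ge0_ler_powR (ltW p0)); rewrite ?nnegrE//.
  exact: orbit_inf_le_iter.
move=> /(ge0_ler_powR (ltW p0)); rewrite !nnegrE powR_ge0 u0 rp.
by move=> /(_ isT isT); rewrite gerDl leNgt e0.
Qed.

(** Continuity from above of a finite measure along the decreasing sets [avoiding], whose
    intersection is empty. *)
Lemma avoiding_small p e r : 0 < p -> 0 < e -> 0 < r ->
  exists m, lam L one (avoiding (near_orbit_inf p e) m) <= r.
Proof.
move=> p0 e0 r0; set G := near_orbit_inf p e.
have mG : measurable G by exact: measurable_near_orbit_inf.
have mA n := measurable_avoiding n mG.
have ni : nonincreasing_seq (avoiding G).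
  apply/nonincreasing_seqP => n; apply/subsetPset.
  elim: n => //= n IH x [/= An Gx]; split => //; exact: IH.
have := nonincreasing_cvg_mu (mu := L) _ mA _ ni.
rewrite (bigcap_avoiding p0 e0) measure0 => /(_ _ _)/fine_cvgP[]//.
- by rewrite -ge0_fin_numE// fin_num_measure.
- move=> _ /cvgrPdist_le /(_ _ r0) [n _ /(_ n (leqnn n))] /= h.
  exists n; have := h; rewrite sub0r normrN => /(le_trans (ler_norm _)).
  by rewrite -(lam1 L (mA n)).
Qed.

Lemma psum_tail (B : nat -> set T) (M r : R) : 0 < r ->
  (forall N, psum L one B N <= M) ->
  exists K, forall N, (K <= N)%N -> psum L one B N <= psum L one B K + r.
Proof.
move=> r0 BM; pose E := range (psum L one B).
have supE : has_sup E.
  by split; [exists (psum L one B 0), 0%N | exists M => _ [N _ <-]].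
have [_ [K _ <-] hK] := sup_adherent r0 supE.
exists K => N _; have : psum L one B N <= sup E.
  by apply: ub_le_sup; [case: supE | exists N].
lra.
Qed.

(* Up to level [K + m] points are stopped only where [y `^ p] is within [r] of
   its infimum along the orbit.  At that level everything is stopped: the mass of
   the points still pending comes either from the tail of the cover beyond [K] or
   from points which avoided [near_orbit_inf] for [m] steps, and is small. *)
Lemma stopping_cover Q (B : nat -> set T) (p e M : R) : 0 < p -> 0 < e ->
  is_cover Si Q B -> (forall N, psum L one B N <= M) ->
  exists B', [/\ is_cover Si Q B',
    forall N, psum L one B' N <= psum L one B N &
    forall N, psum L (fun x => y x `^ p) B' N
              <= psum L (fun x => u x `^ p) B N + e].
Proof.
move=> p0 e0 cB BM; have [mB QB] := cB.
have M0 : 0 <= M by apply: le_trans (BM 0%N); exact: psum_ge0.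
pose Cp := C `^ p; have Cp0 : 0 <= Cp by exact: powR_ge0.
(* The final error is at most [r * M], from stopping within [r] of the infimum, plus [Cp * (3 * r)],
   from the mass stopped late; the summand 1 keeps the denominator positive. *)
pose r := e / (M + 3 * Cp + 1).
have D0 : 0 < M + 3 * Cp + 1 by lra.
have r0 : 0 < r by rewrite divr_gt0.
have re : r * (M + 3 * Cp + 1) = e by rewrite /r divfK// gt_eqF.
have [K BK] := psum_tail r0 BM.
pose G0 := near_orbit_inf p r.
have mG0 : measurable G0 by exact: measurable_near_orbit_inf.
have [m Am] := avoiding_small p0 r0 r0; rewrite -/G0 in Am.
pose G n := if (n < K + m)%N then G0 else setT.
have mG n : measurable (G n) by rewrite /G; case: ifP.
pose B' := stopped S B G.
have mB' n : measurable (B' n) by apply: measurable_stopped.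
have cB' : is_cover Si Q B'.
  by apply: (@stopped_cover _ _ _ _ mS SiK _ _ _ (K + m)) => // n; rewrite /G ltnNge => ->.
have i1 := invariant_cst1.
have le1 N : psum L one B' N <= psum L one B N by exact: psum_stopped.
exists B'; split => //.
have u0 := orbit_inf_ge0 S y_ge0.
have byp : bounded_mfun (fun x => y x `^ p).
  by apply: (bounded_mfun_powR (C := C) (ltW p0)) => // x; rewrite y_ge0 y_leC.
have bup : bounded_mfun (fun x => u x `^ p).
  apply: (bounded_mfun_powR (C := C) (ltW p0)) => [|x].
    exact: (measurable_orbit_inf mS my y_ge0).
  by rewrite u0 (orbit_inf_leC S y_ge0 y_leC).
have iup : invariant_density L S (fun x => u x `^ p).
  exact: (invariant_comp_orbit_inf mS LS my y_ge0 y_leC (phi := fun s => s `^ p)).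
(* The tail of the cover beyond level [K], with levels counted from [K]; [V] collects all points it
   has reached. *)
pose Bv n := if n is k.+1 then B (K + n)%N else set0.
have mBv n : measurable (Bv n) by case: n => [|n] /=.
pose V := pending S Bv (fun=> set0).
have mV n : measurable (V n) by apply: measurable_pending.
(* A point pending [k] levels after [K] entered through the tail, or was already pending at level
   [K] and has avoided [G0] ever since. *)
have pendV k : (k <= m)%N ->
    pending S B G (K + k) `<=` V k `|` avoiding G0 k.
  elim: k => [|k IH] km; first by move=> x _; right.
  rewrite addnS /= => x [[/= Px Gx]|Bx]; last by left; right; rewrite /= addnS.
  have := IH (ltnW km) _ Px.
  move: Gx; rewrite /G ltn_add2l km => Gx [Vx|Ax]; last by right.
  by left; left; split.
have lamV k : lam L one (V k) <= r.
  apply: (@le_trans _ _ (psum L one Bv k.+1)).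
    apply: le_trans (lam_pendingD_psum mS k bone one0 i1 mBv (fun=> measurable0)).
    by rewrite lerDl psum_ge0.
  have -> : psum L one Bv k.+1 = psum L one B (K + k.+1) - psum L one B K.+1.
    elim: k => [|k IH].
      by rewrite /psum big_nat1 /= addn1 subrr /lam Rintegral_set0.
    rewrite psumS IH addnS [in RHS]addnS [in RHS]psumS /= addnS; ring.
  have := BK (K + k.+1)%N (leq_addr _ _).
  have : psum L one B K <= psum L one B K.+1.
    by rewrite psumS lerDl lam_ge0.
  lra.
have lamP : lam L one (pending S B G (K + m)) <= 2 * r.
  have mP : measurable (pending S B G (K + m)) by exact: measurable_pending.
  have mA := measurable_avoiding m mG0.
  have := lam_sub L bone one0 mP (measurableU _ _ (mV m) mA) (pendV _ (leqnn m)).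
  have := lam_subU L bone one0 (mV m) mA.
  have := lamV m; lra.
(* The mass stopped at level [K + m] or later. At [K + m] it is at most [2 * r]; afterwards nothing
   is carried over, so [B' n] lies in [B n] and the tail of the cover adds at most [r]. *)
pose late N := \sum_(0 <= n < N) if (K + m <= n)%N then lam L one (B' n) else 0.
have lateE k : late (K + m + k.+1)%N <=
    2 * r + psum L one B (K + m + k.+1) - psum L one B (K + m).+1.
  elim: k => [|k IH].
    rewrite /late addn1 big_nat_recr//= leqnn big_nat big1 ?add0r => [|n].
      rewrite addrK; apply: le_trans lamP; apply: lam_sub => //.
      - exact: measurable_pending.
      - by move=> x [].
    by move=> /andP[_ nN]; rewrite leqNgt nN.
  rewrite /late addnS big_nat_recr//= -/(late _) leq_addr.
  rewrite psumS.
  have : lam L one (B' (K + m + k.+1)%N) <= lam L one (B (K + m + k.+1)%N).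
    apply: (lam_sub L bone one0) => // x []; rewrite addnS /= => -[[_]|//].
    by move=> nG; exfalso; apply: nG; rewrite /G ltnNge leq_addr.
  lra.
have late3 N : late N <= 3 * r.
  have [NK|KN] := leqP N (K + m).
    rewrite /late big_nat big1 => [|n]; first lra.
    by move=> /andP[_ nN]; rewrite leqNgt (leq_trans nN).
  rewrite -(subnKC KN) addSnnS; apply: le_trans (lateE _) _.
  have := BK (K + m + (N - (K + m).+1).+1)%N; rewrite -addnA leq_addr => /(_ isT).
  have : psum L one B K <= psum L one B (K + m).+1.
    rewrite [leRHS]/psum (big_cat_nat _ (n := K))//= ?lerDl ?ltnS ?leq_addr//.
      by apply: sumr_ge0 => n _; exact: lam_ge0.
    by rewrite -addnS leq_addr.
  lra.
move=> N.
have b1 := bounded_mfunZ r bone.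
(* Early levels use the tolerance [r] of [G0]; late levels only the crude bound of [y ^ p] by [Cp],
   which suffices as their mass is small. *)
have step n : lam L (fun x => y x `^ p) (B' n) <=
    (lam L (fun x => u x `^ p) (B' n) + r * lam L one (B' n))
    + Cp * (if (K + m <= n)%N then lam L one (B' n) else 0).
  have rl0 : 0 <= r * lam L one (B' n) by apply: mulr_ge0; [exact: ltW | exact: lam_ge0].
  have lu0 : 0 <= lam L (fun x => u x `^ p) (B' n).
    by apply: lam_ge0 => x; exact: powR_ge0.
  case: ifPn => [_|nK].
    have : lam L (fun x => y x `^ p) (B' n) <= lam L (fun x => Cp * one x) (B' n).
      apply: le_lam => //; first exact: bounded_mfunZ.
      move=> x _; rewrite mulr1; apply: (ge0_ler_powR (ltW p0)) => //.
      - by rewrite nnegrE.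
      - by rewrite nnegrE (le_trans (y_ge0 x)).
    rewrite lamZ//; lra.
  rewrite mulr0 addr0 -lamZ// -lamD//; apply: le_lam => //.
    exact: bounded_mfunD.
  by move=> x []; rewrite /G ltnNge nK /= mulr1.
apply: le_trans (ler_sum _ (fun n _ => step n)) _.
rewrite big_split big_split/= -!mulr_sumr -/(late N).
have := psum_stopped mS N bup (fun x => powR_ge0 _ _) iup mB mG.
have h1 : r * psum L one B' N <= r * M.
  by rewrite ler_pM2l//; apply: le_trans (le1 N) (BM N).
have h2 : Cp * late N <= Cp * (3 * r) by rewrite ler_wpM2l.
rewrite -/B' -!/(psum _ _ _ _) => h3.
have : r * M + Cp * (3 * r) <= e by rewrite -re; lra.
lra.
Qed.

End stopping.

(** * Taylor expansion of powers in the exponent *)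

Section powR_exponent.
Context {R : realType}.
Implicit Types a s t x C : R.

(** Applying [1 + z <= expR z] at [x] and at [- x] places the remainder between 0 and
    [x * (expR x - 1)]. *)
Lemma norm_expR_sub1x x : `|expR x - 1 - x| <= x ^+ 2 * expR `|x|.
Proof.
have h1 := expR_ge1Dx x; have h2 := expR_ge1Dx (- x).
have e0 := expR_gt0 x.
have h3 : expR x * (1 - x) <= 1.
  by rewrite -[leRHS](expRxMexpNx_1 x) ler_pM2l//; move: h2; lra.
rewrite ger0_norm; last by lra.
apply: (@le_trans _ _ (x * (expR x - 1))).
  by move: h3; rewrite mulrBr mulr1 mulrBr mulr1 [expR x * x]mulrC; lra.
have [x0|x0] := leP 0 x.
  rewrite ger0_norm// expr2 -mulrA ler_wpM2l//.
  by move: h3; rewrite mulrBr mulr1 [expR x * x]mulrC; lra.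
have : 1 <= expR `|x| by rewrite -expR0 ler_expR.
move=> h4; apply: (@le_trans _ _ (x ^+ 2 * 1)); last by rewrite ler_wpM2l ?sqr_ge0.
nra.
Qed.

Lemma sqr_le_expR x : 0 <= x -> x ^+ 2 <= 4 * expR x.
Proof.
move=> x0; have h := expR_ge1Dx (x / 2).
have -> : expR x = expR (x / 2) ^+ 2 by rewrite -expRM_natl; congr expR; lra.
nra.
Qed.

(** With [s = 1 / Z] this is the density of [Z ^ a dphi0] with respect to [Lambda]. *)
Definition powR_compl a s := s `^ (1 - a).

(** The derivative of [powR_compl a s] in the exponent [a]. *)
Definition dpowR_compl a s := - (s `^ (1 - a) * ln s).

(** With [l = ln s] the remainder is at most [t ^ 2 * l ^ 2 * expR ((1 - a) * l + k * |l|)]. As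
    [1 - a = 2 * k], the exponent is [k * l] for [l < 0], which beats [l ^ 2] near [s = 0] and gives
    the term [4 / k ^ 2] of [K]; for [l >= 0] it is [3 * k * l], bounded through [l <= M]. *)
Lemma powR_compl_taylor a C : 0 < C -> a < 1 ->
  exists k K : R, [/\ 0 < k, 0 <= K & forall t s, `|t| <= k -> 0 <= s <= C ->
    `|powR_compl (a + t) s - powR_compl a s - t * dpowR_compl a s| <= K * t ^+ 2].
Proof.
move=> C0 a1; pose k := (1 - a) / 2; pose M := `|ln C|.
have k0 : 0 < k by rewrite /k; lra.
pose K := 4 / k ^+ 2 + M ^+ 2 * expR (3 * k * M).
have K1 : 0 <= 4 / k ^+ 2 by rewrite divr_ge0// sqr_ge0.
have K2 : 0 <= M ^+ 2 * expR (3 * k * M) by rewrite mulr_ge0 ?sqr_ge0 ?expR_ge0.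
exists k, K; split => //; first exact: addr_ge0.
move=> t s tk /andP[s0 sC]; have /andP[tk1 tk2] : - k <= t <= k by rewrite -ler_norml.
rewrite /powR_compl /dpowR_compl.
(* At [s = 0] every term vanishes: [|t| <= k] keeps both exponents positive. *)
have [->|sn0] := eqVneq s 0.
  have p1 : 1 - a != 0 by rewrite gt_eqF//; lra.
  have p2 : 1 - (a + t) != 0 by rewrite gt_eqF//; rewrite /k in tk2; lra.
  rewrite !powR0// mul0r oppr0 mulr0 oppr0 !addr0 normr0.
  by rewrite mulr_ge0 ?sqr_ge0// addr_ge0.
have {sn0}s0 : 0 < s by rewrite lt_neqAle eq_sym sn0.
set l := ln s; have lM : l <= M.
  by rewrite (le_trans _ (ler_norm _))// ler_ln.
rewrite /powR gt_eqF// -/l.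
have -> : (1 - (a + t)) * l = (1 - a) * l + (- t * l) by ring.
rewrite expRD; set E := expR ((1 - a) * l).
have E0 : 0 < E := expR_gt0 _.
have -> : E * expR (- t * l) - E - t * - (E * l) =
    E * (expR (- t * l) - 1 - (- t * l)) by ring.
rewrite normrM (gtr0_norm E0).
apply: (@le_trans _ _ (t ^+ 2 * (l ^+ 2 * expR ((1 - a) * l + k * `|l|)))).
  apply: (@le_trans _ _ (E * ((- t * l) ^+ 2 * expR `|- t * l|))).
    by rewrite ler_pM2l// norm_expR_sub1x.
  have -> : E * ((- t * l) ^+ 2 * expR `|- t * l|) =
    t ^+ 2 * (l ^+ 2 * (E * expR `|- t * l|)) by ring.
  rewrite ler_wpM2l ?sqr_ge0// ler_wpM2l ?sqr_ge0// /E -expRD ler_expR lerD2l.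
  by rewrite normrM normrN ler_wpM2r.
rewrite mulrC ler_wpM2r ?sqr_ge0//.
have -> : 1 - a = 2 * k by rewrite /k; lra.
have [l0|l0] := leP 0 l.
  rewrite ger0_norm//; apply: ler_wpDl => //.
  apply: ler_pM; rewrite ?sqr_ge0 ?expR_ge0//.
    by rewrite !expr2; apply: ler_pM.
  by rewrite ler_expR; have := ler_wpM2l (ltW k0) lM; lra.
rewrite ltr0_norm//; apply: ler_wpDr => //.
have kl : 0 <= k * - l by rewrite mulr_ge0 ?ltW// oppr_gt0.
have := sqr_le_expR kl.
rewrite ler_pdivlMr ?exprn_gt0//.
have -> : 2 * k * l + k * - l = - (k * - l) by ring.
rewrite expRN => h; have e0 := expR_gt0 (k * - l).
have -> : l ^+ 2 / expR (k * - l) * k ^+ 2 = (k * - l) ^+ 2 / expR (k * - l) by ring.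
by rewrite ler_pdivrMr.
Qed.

(** Read off from the Taylor expansion at one fixed increment [k']: the powers at [a] and [a + k']
    are bounded on the interval, and so is the remainder. *)
Lemma dpowR_compl_bounded a C : 0 < C -> a < 1 ->
  exists M : R, forall s, 0 <= s <= C -> `|dpowR_compl a s| <= M.
Proof.
move=> C0 a1; have [k [K [k0 K0 taylor]]] := powR_compl_taylor C0 a1.
pose k' := Num.min k ((1 - a) / 2).
have k'0 : 0 < k' by rewrite /k' lt_min k0; lra.
have k'k : k' <= k by rewrite /k' ge_min lexx.
have k'a : k' <= (1 - a) / 2 by rewrite /k' ge_min lexx orbT.
pose D b := powR_compl b C.
exists ((D (a + k') + D a + K * k' ^+ 2) / k') => s sC; have /andP[s0 sleC] := sC.
rewrite ler_pdivlMr// -[X in _ * X]gtr0_norm// -normrM mulrC.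
have bound b : b < 1 -> 0 <= powR_compl b s <= D b.
  move=> b1; rewrite powR_ge0/=; apply: ge0_ler_powR; rewrite ?nnegrE//; lra.
have /bound/andP[h1 h2] : a + k' < 1 by lra.
have /andP[h3 h4] := bound _ a1.
have := taylor k' s; rewrite (gtr0_norm k'0) => /(_ k'k sC).
by rewrite !ler_norml => /andP[h5 h6]; apply/andP; split; lra.
Qed.

Lemma measurable_dpowR_compl a : measurable_fun setT (dpowR_compl a).
Proof.
by apply: measurable_funN; apply: measurable_funM => //; exact: measurable_powR.
Qed.

End powR_exponent.

(** * Nearly optimal covers *)

Section limit_functional.
Context d (T : measurableType d) (R : realType).
Variables (L : {finite_measure set T -> \bar R}).
Implicit Types (f g : T -> R) (B : nat -> set T).

Local Notation one := (cst (1 : R) : T -> R).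
Local Notation psum := (psum L).

Let bone : bounded_mfun one. Proof. exact: bounded_mfun_cst. Qed.

Definition finite_cost B := (forall n, measurable (B n)) /\
  exists M, forall N, psum one B N <= M.

Definition lsum f B : R := limn (psum f B).

Lemma psum_nondecreasing f B : (forall x, 0 <= f x) ->
  nondecreasing_seq (psum f B).
Proof.
by move=> f0; apply/nondecreasing_seqP => N; rewrite psumS lerDl lam_ge0.
Qed.

Lemma psumD f g B N : bounded_mfun f -> bounded_mfun g ->
  (forall n, measurable (B n)) ->
  psum (fun x => f x + g x) B N = psum f B N + psum g B N.
Proof.
by move=> bf bg mB; rewrite -big_split/=; apply: eq_bigr => n _; rewrite lamD.
Qed.

Lemma psumZ r f B N : bounded_mfun f -> (forall n, measurable (B n)) ->
  psum (fun x => r * f x) B N = r * psum f B N.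
Proof.
by move=> bf mB; rewrite mulr_sumr; apply: eq_bigr => n _; rewrite lamZ.
Qed.

Lemma le_psum f g B N : bounded_mfun f -> bounded_mfun g ->
  (forall n, measurable (B n)) -> (forall x, f x <= g x) ->
  psum f B N <= psum g B N.
Proof. by move=> bf bg mB fg; apply: ler_sum => n _; apply: le_lam. Qed.

Lemma psum_le_cst f B N (M : R) : bounded_mfun f -> (forall n, measurable (B n)) ->
  (forall x, f x <= M) -> psum f B N <= M * psum one B N.
Proof.
move=> bf mB fM; rewrite -psumZ//; apply: le_psum => //.
  exact: bounded_mfunZ.
by move=> x; rewrite mulr1.
Qed.

Lemma cvg_psum_ge0 f B : bounded_mfun f -> (forall x, 0 <= f x) ->
  finite_cost B -> cvgn (psum f B).
Proof.
move=> bf f0 [mB [M BM]]; have [_ [M' fM]] := bf.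
apply: nondecreasing_is_cvgn; first exact: psum_nondecreasing.
exists (`|M'| * M) => _ [N _ <-].
apply: (@le_trans _ _ (`|M'| * psum one B N)); last by rewrite ler_wpM2l.
apply: psum_le_cst => // x.
by rewrite (le_trans (ler_norm _))// (le_trans (fM x))// ler_norm.
Qed.

(** Adding a constant [M] that dominates [|f|] reduces to nonnegative densities, whose partial sums
    are monotone and bounded. *)
Lemma cvg_psum f B : bounded_mfun f -> finite_cost B ->
  psum f B @ \oo --> lsum f B.
Proof.
move=> bf cB; have [mB _] := cB; have [_ [M fM]] := bf.
have bM := bounded_mfunZ M bone; have bfM := bounded_mfunD bf bM.
suff : cvgn (psum f B) by [].
have -> : psum f B = psum (fun x => f x + M * one x) B - M \*: psum one B.
  apply/funext => N.
  change (psum f B N = psum (fun x => f x + M * one x) B N - M * psum one B N).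
  by rewrite psumD// psumZ// addrK.
apply: is_cvgB; last by apply: is_cvgZr; exact: cvg_psum_ge0.
apply: cvg_psum_ge0 => // x; have := fM x; rewrite ler_norml mulr1; lra.
Qed.

Lemma lsumD f g B : bounded_mfun f -> bounded_mfun g -> finite_cost B ->
  lsum (fun x => f x + g x) B = lsum f B + lsum g B.
Proof.
move=> bf bg cB; have [mB _] := cB; apply/cvg_lim => //.
rewrite (_ : psum _ B = psum f B + psum g B).
  by apply: cvgD; exact: cvg_psum.
by apply/funext => N; rewrite psumD.
Qed.

Lemma lsumZ r f B : bounded_mfun f -> finite_cost B ->
  lsum (fun x => r * f x) B = r * lsum f B.
Proof.
move=> bf cB; have [mB _] := cB; apply/cvg_lim => //.
rewrite (_ : psum _ B = r \*: psum f B).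
  by apply: cvgZr; exact: cvg_psum.
by apply/funext => N; rewrite psumZ.
Qed.

Lemma le_lsum f g B : bounded_mfun f -> bounded_mfun g -> finite_cost B ->
  (forall x, f x <= g x) -> lsum f B <= lsum g B.
Proof.
move=> bf bg cB fg; apply: ler_cvg_to (cvg_psum bf cB) (cvg_psum bg cB) _.
by near=> N; apply: le_psum => //; case: cB.
Unshelve. all: by end_near. Qed.

Lemma lsum_le f B r : bounded_mfun f -> finite_cost B ->
  (forall N, psum f B N <= r) -> lsum f B <= r.
Proof.
move=> bf cB fr; apply: limr_le; first exact: cvg_psum.
by near=> N.
Unshelve. all: by end_near. Qed.

Lemma psum_le_lsum f B N : bounded_mfun f -> (forall x, 0 <= f x) ->
  finite_cost B -> psum f B N <= lsum f B.
Proof.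
move=> bf f0 cB; apply: nondecreasing_cvgn_le; first exact: psum_nondecreasing.
exact: cvg_psum.
Qed.

Lemma lsum_norm_le f B (M : R) : bounded_mfun f -> finite_cost B ->
  (forall x, `|f x| <= M) -> `|lsum f B| <= M * lsum one B.
Proof.
move=> bf cB fM; rewrite ler_norml -mulNr -!lsumZ//.
have b r : bounded_mfun (fun x => r * one x) by exact: bounded_mfunZ.
by apply/andP; split; apply: le_lsum => // x; have := fM x;
  rewrite ler_norml mulr1 => /andP[].
Qed.

End limit_functional.

(** * Costs along nearly optimal covers and the expansion of the optimal cost *)

Section near_optimal_covers.
Context d (T : measurableType d) (R : realType).
Variables (L : {finite_measure set T -> \bar R}) (S Si : T -> T).
Hypotheses (mS : measurable_fun setT S) (SiK : cancel Si S).
Hypothesis LS : forall A, measurable A -> L (S @^-1` A) = L A.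
Variables (y : T -> R) (C : R).
Hypotheses (my : measurable_fun setT y) (y_ge0 : forall x, 0 <= y x)
  (C_gt0 : 0 < C) (y_leC : forall x, y x <= C).
(* [mu] stands for the outer measure of [Q]. *)
Variables (Q : set T) (mu : R).

Local Notation one := (cst (1 : R) : T -> R).
Local Notation u := (orbit_inf S y).
Local Notation psum := (psum L).
Local Notation lsum := (lsum L).

Hypothesis mu_lb : forall B r, is_cover Si Q B ->
  (forall N, psum one B N <= r) -> mu <= r.

(** A bound [r] strictly below [mu + e] expresses that the total cost, and not just each partial
    sum, is less than [mu + e]. *)
Definition near_optimal (e : R) (B : nat -> set T) :=
  is_cover Si Q B /\ exists2 r, r < mu + e & forall N, psum one B N <= r.

Hypothesis near_optimal_ex : forall e : R, 0 < e -> exists B, near_optimal e B.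

Let bone : bounded_mfun one. Proof. exact: bounded_mfun_cst. Qed.
Let one0 (x : T) : 0 <= one x. Proof. exact: ler01. Qed.
Let u0 : forall x, 0 <= u x. Proof. exact: orbit_inf_ge0. Qed.
Let uC : forall x, u x <= C. Proof. exact: orbit_inf_leC. Qed.

Lemma near_optimal_finite e B : near_optimal e B -> finite_cost L B.
Proof. by move=> [[mB _] [r _ hr]]; split => //; exists r. Qed.

Lemma lsum1_near_optimal e B : near_optimal e B -> mu <= lsum one B < mu + e.
Proof.
move=> oB; have fB := near_optimal_finite oB; have [cB [r re hr]] := oB.
rewrite (mu_lb cB) => [/=|N]; last exact: psum_le_lsum.
by apply: le_lt_trans re; exact: lsum_le.
Qed.

(* For an invariant density [f], a common refinement costs no more than either
   cover; comparing the costs of [f] and [M - f] on it shows that a cover which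
   is nearly optimal for the density 1 is nearly optimal for [f] as well. *)
Lemma near_optimal_invariant f (M e r : R) B B' : bounded_mfun f ->
  (forall x, 0 <= f x <= M) -> invariant_density L S f ->
  near_optimal e B -> is_cover Si Q B' ->
  (forall N, psum f B' N <= r) -> lsum f B <= r + M * e.
Proof.
move=> bf fM fS oB cB' fr; have fB := near_optimal_finite oB.
have [cB _] := oB; have [mB _] := cB.
have f0 x : 0 <= f x by case/andP: (fM x).
have fle x : f x <= M by case/andP: (fM x).
have M0 : 0 <= M := le_trans (f0 point) (fle point).
have [E [cE hE]] := common_refinement L mS SiK cB cB'; have [mE _] := cE.
have i1 : invariant_density L S one := invariant_cst1 mS LS.
pose g x := M * one x + (-1) * f x.
have bg : bounded_mfun g by apply: bounded_mfunD; exact: bounded_mfunZ.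
have g0 x : 0 <= g x by rewrite /g mulr1; have := fle x; lra.
have gS : invariant_density L S g.
  move=> A mA; have mSA := measurable_preimS mS mA.
  have bM1 := bounded_mfunZ M bone; have bf1 := bounded_mfunZ (-1) bf.
  by rewrite /g !lamD// !lamZ// i1// fS.
have fE : finite_cost L E.
  split => //; have [_ [K BK]] := fB; exists K => N.
  by case: (hE one bone one0 i1 N) => /le_trans + _; apply.
have gE D : finite_cost L D -> lsum g D = M * lsum one D - lsum f D.
  move=> fD; rewrite lsumD ?lsumZ//; try exact: bounded_mfunZ.
  by rewrite mulN1r.
have h1 : lsum f E <= r.
  by apply: lsum_le => // N; case: (hE f bf f0 fS N) => _ /le_trans; apply.
have h2 : lsum g E <= lsum g B.
  apply: lsum_le => // N; case: (hE g bg g0 gS N) => /le_trans + _; apply.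
  exact: psum_le_lsum.
have h3 : mu <= lsum one E by apply: mu_lb cE _ => N; exact: psum_le_lsum.
have /andP[_ h4] := lsum1_near_optimal oB.
rewrite !gE// in h2.
have := ler_wpM2l M0 h3; have := ler_wpM2l M0 (ltW h4); lra.
Qed.

(** The shifted density [g] has values in [[0, 2 * M]], so its cost along [B] exceeds the infimum
    over nearly optimal covers by at most [2 * M * e]. Removing the shift costs another [M * e],
    since [B] has total mass within [e] of [mu]. *)
Lemma lsum_invariant_limit f (M : R) : bounded_mfun f ->
  (forall x, `|f x| <= M) -> invariant_density L S f ->
  exists D : R, forall e B, 0 < e <= 1 -> near_optimal e B ->
    `|lsum f B - D| <= 3 * M * e.
Proof.
move=> bf fM fS; have M0 : 0 <= M := le_trans (normr_ge0 _) (fM point).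
have i1 : invariant_density L S one := invariant_cst1 mS LS.
have bM1 := bounded_mfunZ M bone.
pose g x := f x + M * one x.
have bg : bounded_mfun g by exact: bounded_mfunD.
have gM x : 0 <= g x <= 2 * M.
  by have := fM x; rewrite /g mulr1 ler_norml => /andP[? ?]; apply/andP; split; lra.
have gS : invariant_density L S g.
  move=> A mA; have mSA := measurable_preimS mS mA.
  by rewrite /g !lamD// !lamZ// i1// fS.
have gle e B B' : near_optimal e B -> near_optimal 1 B' ->
    lsum g B <= lsum g B' + 2 * M * e.
  move=> oB oB'; apply: (near_optimal_invariant bg gM gS oB (proj1 oB')) => N.
  apply: psum_le_lsum => // [x|]; first by case/andP: (gM x).
  exact: near_optimal_finite oB'.
pose V := [set lsum g B | B in near_optimal 1].
have [B1 oB1] := near_optimal_ex ltr01.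
have infV : has_inf V.
  split; first by exists (lsum g B1), B1.
  exists 0 => _ [B oB <-]; have fB := near_optimal_finite oB.
  apply: le_trans (psum_le_lsum 0 bg _ fB) => [|x]; last by case/andP: (gM x).
  by apply: psum_ge0 => x; case/andP: (gM x).
exists (inf V - M * mu) => e B /andP[e0 e1] oB.
have fB := near_optimal_finite oB.
have oB' : near_optimal 1 B.
  case: oB => cB [r re hr]; split => //; exists r => //.
  by rewrite (lt_le_trans re)// lerD2l.
have h1 : inf V <= lsum g B by apply: ge_inf; [case: infV | exists B].
have h2 : lsum g B - 2 * M * e <= inf V.
  apply: lb_le_inf; first by case: infV.
  by move=> _ [B' oB2 <-]; rewrite lerBlDr; exact: gle.
have hg : lsum g B = lsum f B + M * lsum one B by rewrite lsumD// lsumZ.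
have /andP[h3 h4] := lsum1_near_optimal oB.
have := ler_wpM2l M0 h3; have := ler_wpM2l M0 (ltW h4).
have := mulr_ge0 M0 (ltW e0).
by rewrite ler_norml => *; apply/andP; split; lra.
Qed.

Local Notation phi a := (powR_compl a).

Let byp a : a < 1 -> bounded_mfun (fun x => phi a (y x)).
Proof.
move=> a1; apply: (bounded_mfun_powR (C := C)) => // [|x]; first by lra.
by rewrite y_ge0 y_leC.
Qed.

Let bup a : a < 1 -> bounded_mfun (fun x => phi a (u x)).
Proof.
move=> a1; apply: (bounded_mfun_powR (C := C)) => [||x]; first by lra.
  exact: measurable_orbit_inf.
by rewrite u0 uC.
Qed.

Let phi_mono (a s t : R) : a < 1 -> 0 <= s <= t -> phi a s <= phi a t.
Proof.
move=> a1 /andP[s0 st]; apply: ge0_ler_powR; rewrite ?nnegrE//; first by lra.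
exact: le_trans st.
Qed.

Let phiuC (a : R) x : a < 1 -> 0 <= phi a (u x) <= phi a C.
Proof. by move=> a1; rewrite powR_ge0 phi_mono// u0 uC. Qed.

(* [h a] stands for [calH] with exponent [a]. *)
Variable h : R -> R.
Hypothesis h_lb : forall a B r, 0 < a < 1 -> is_cover Si Q B ->
  (forall N, psum (fun x => phi a (y x)) B N <= r) -> h a <= r.
Hypothesis h_ex : forall a e : R, 0 < a < 1 -> 0 < e ->
  exists2 B, is_cover Si Q B &
    forall N, psum (fun x => phi a (y x)) B N <= h a + e.

Lemma near_optimal_stopping a e e' B : 0 < a < 1 -> 0 < e' -> near_optimal e B ->
  exists2 B', near_optimal e B' &
    forall N, psum (fun x => phi a (y x)) B' N
              <= lsum (fun x => phi a (u x)) B + e'.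
Proof.
move=> /andP[a0 a1] e'0 oB; have fB := near_optimal_finite oB.
have [cB [r re hr]] := oB.
have p0 : 0 < 1 - a by lra.
have [B' [cB' h1 h2]] :=
  stopping_cover mS SiK LS my y_ge0 y_leC p0 e'0 cB hr.
exists B'.
  by split => //; exists r => // N; exact: le_trans (hr N).
move=> N; apply: le_trans (h2 N) _; rewrite lerD2r.
apply: psum_le_lsum => //; first exact: bup.
by move=> x; exact: powR_ge0.
Qed.

(** Lower bound: stopping turns [B] into a cover whose cost for [y] is almost the cost of [B] for
    [u]. Upper bound: for a cover almost attaining [h a], replacing [y] by the smaller [u] only
    lowers the cost, and [B] is nearly optimal for the invariant density. *)
Lemma near_optimal_h a e B : 0 < a < 1 -> near_optimal e B ->
  h a <= lsum (fun x => phi a (u x)) B <= h a + phi a C * e.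
Proof.
move=> a01 oB; have /andP[a0 a1] := a01; apply/andP; split.
  apply/ler_addgt0Pr => e' e'0.
  have [B' [cB' _] h1] := near_optimal_stopping a01 e'0 oB.
  exact: h_lb cB' h1.
apply/ler_addgt0Pr => e' e'0; have [B' cB' h1] := h_ex a01 e'0.
rewrite addrAC; apply: (near_optimal_invariant (bup a1) _ _ oB cB').
- by move=> x; exact: phiuC.
- exact: (invariant_comp_orbit_inf mS LS my y_ge0 y_leC (bup a1)).
- move=> N; apply: le_trans (h1 N); have [mB' _] := cB'.
  apply: le_psum => //; [exact: bup|exact: byp|] => x.
  by apply: phi_mono => //; rewrite u0 (orbit_inf_le S y_ge0 x 0).
Qed.

Lemma near_optimal_both (a e : R) : 0 < a < 1 -> 0 < e ->
  exists2 B, near_optimal e B &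
    forall N, psum (fun x => phi a (y x)) B N <= h a + e.
Proof.
move=> a01 e0; have D0 : 0 < 1 + phi a C by rewrite ltr_pwDl ?powR_ge0.
(* Half of [e] pays for the distance from [h a] to the cost for [u], the other half for stopping. *)
pose e1 : R := Num.min e (e / 2 / (1 + phi a C)).
have e10 : 0 < e1 by rewrite /e1 lt_min e0 !divr_gt0.
have [B oB] := near_optimal_ex e10.
have e20 : 0 < e / 2 by rewrite divr_gt0.
have [B' oB' h1] := near_optimal_stopping a01 e20 oB.
exists B'.
  case: oB' => cB' [r re hr]; split => //; exists r => //.
  by rewrite (lt_le_trans re)// lerD2l /e1 ge_min lexx.
move=> N; apply: le_trans (h1 N) _.
have /andP[_ h2] := near_optimal_h a01 oB.
have : phi a C * e1 <= e / 2.
  apply: (@le_trans _ _ ((1 + phi a C) * e1)); first by rewrite ler_wpM2r ?ltW// ltrDr.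
  by rewrite mulrC -ler_pdivlMr// /e1 ge_min lexx orbT.
lra.
Qed.

Lemma near_optimal_le e e' B : e <= e' -> near_optimal e B -> near_optimal e' B.
Proof.
move=> ee' [cB [r re hr]]; split => //; exists r => //.
by rewrite (lt_le_trans re)// lerD2l.
Qed.

Local Notation dphi a := (dpowR_compl a).

Lemma bounded_mfun_dphi a (v : T -> R) : a < 1 -> measurable_fun setT v ->
  (forall x, 0 <= v x <= C) -> bounded_mfun (fun x => dphi a (v x)).
Proof.
move=> a1 mv vC; split; first exact: (measurableT_comp (measurable_dpowR_compl a) mv).
have [M hM] := dpowR_compl_bounded C_gt0 a1.
by exists M => x; exact: hM.
Qed.

Lemma lsum_taylor a k K (v : T -> R) B t : a < 1 -> a + t < 1 ->
  (forall t s, `|t| <= k -> 0 <= s <= C ->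
    `|phi (a + t) s - phi a s - t * dphi a s| <= K * t ^+ 2) ->
  measurable_fun setT v -> (forall x, 0 <= v x <= C) -> finite_cost L B ->
  `|t| <= k ->
  `|lsum (fun x => phi (a + t) (v x)) B - lsum (fun x => phi a (v x)) B
    - t * lsum (fun x => dphi a (v x)) B| <= K * t ^+ 2 * lsum one B.
Proof.
move=> a1 at1 taylor mv vC fB tk.
have bp b : b < 1 -> bounded_mfun (fun x => phi b (v x)).
  by move=> b1; apply: (bounded_mfun_powR (C := C)) => //; lra.
have bd := bounded_mfun_dphi a1 mv vC.
have b1 := bp _ at1.
have b2 := bounded_mfunZ (-1) (bp _ a1).
have b3 := bounded_mfunZ (- t) bd.
have b12 := bounded_mfunD b1 b2.
have -> : lsum (fun x => phi (a + t) (v x)) B - lsum (fun x => phi a (v x)) B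
    - t * lsum (fun x => dphi a (v x)) B =
    lsum (fun x => phi (a + t) (v x) + (-1) * phi a (v x) + - t * dphi a (v x)) B.
  by rewrite lsumD// lsumD// !lsumZ//; [rewrite mulN1r mulNr | exact: bp].
apply: lsum_norm_le => // [|x]; first exact: bounded_mfunD.
by rewrite mulN1r mulNr; exact: taylor.
Qed.

Lemma h_expansion a : 0 < a < 1 -> exists D,
  [/\ exists k K : R, 0 < k /\ forall t, `|t| <= k ->
        `|h (a + t) - h a - t * D| <= K * t ^+ 2
    & forall eta, 0 < eta -> exists2 e0, 0 < e0 &
        forall e B, 0 < e <= e0 -> near_optimal e B ->
          (forall N, psum (fun x => phi a (y x)) B N <= h a + e) ->
          `|lsum (fun x => dphi a (y x)) B - D| <= eta].
Proof.
move=> a01; have /andP[a0 a1] := a01.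
have [k0 [K [k00 K0 taylor0]]] := powR_compl_taylor C_gt0 a1.
(* Besides staying in the range of the expansion, [|t| <= k] keeps [a + t] inside (0,1). *)
pose k : R := Num.min k0 (Num.min (a / 2) ((1 - a) / 2)).
have k_gt0 : 0 < k by rewrite /k !lt_min k00/= !divr_gt0//= subr_gt0.
have kk0 : k <= k0 by rewrite /k ge_min lexx.
have ka : k <= a / 2 by rewrite /k !ge_min lexx orbT.
have k1a : k <= (1 - a) / 2 by rewrite /k !ge_min lexx !orbT.
have taylor t s : `|t| <= k -> 0 <= s <= C ->
    `|phi (a + t) s - phi a s - t * dphi a s| <= K * t ^+ 2.
  by move=> tk; apply: taylor0; exact: le_trans kk0.
have mu_ := measurable_orbit_inf mS my y_ge0.
have uC2 x : 0 <= u x <= C by rewrite u0 uC.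
have yC2 x : 0 <= y x <= C by rewrite y_ge0 y_leC.
have bdu := bounded_mfun_dphi a1 mu_ uC2.
have bdy := bounded_mfun_dphi a1 my yC2.
have idu : invariant_density L S (fun x => dphi a (u x)).
  exact: (invariant_comp_orbit_inf mS LS my y_ge0 y_leC bdu).
have [M hM] := dpowR_compl_bounded C_gt0 a1.
have [D hD] := lsum_invariant_limit bdu (fun x => hM _ (uC2 x)) idu.
have M0 : 0 <= M := le_trans (normr_ge0 _) (hM _ (uC2 point)).
have at01 t : `|t| <= k -> 0 < a + t < 1.
  by rewrite ler_norml => /andP[? ?]; apply/andP; split; lra.
have expand t : `|t| <= k -> `|h (a + t) - h a - t * D| <= K * t ^+ 2 * (mu + 1).
  move=> tk; have at0 := at01 _ tk; have /andP[at0' at1] := at0.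
  (* Along one nearly optimal cover, [h (a + t)], [h a] and [t * D] are compared with the
     corresponding costs for [u]; [W * e] is the total error, made smaller than [e'] by the choice
     of [e]. *)
  pose W := phi (a + t) C + phi a C + `|t| * (3 * M).
  have W0 : 0 <= W by rewrite !addr_ge0 ?powR_ge0 ?mulr_ge0.
  apply/ler_addgt0Pr => e' e'0.
  pose e : R := Num.min 1 (e' / (W + 1)).
  have e0 : 0 < e by rewrite /e lt_min ltr01 divr_gt0// ltr_pwDr.
  have e1 : e <= 1 by rewrite /e ge_min lexx.
  have We : W * e <= e'.
    apply: (@le_trans _ _ ((W + 1) * e)); first by rewrite ler_wpM2r ?ltW// ltrDl.
    by rewrite mulrC -ler_pdivlMr ?ltr_pwDr// /e ge_min lexx orbT.
  have [B oB] := near_optimal_ex e0; have fB := near_optimal_finite oB.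
  have e01 : 0 < e <= 1 by rewrite e0.
  have := hD e B e01 oB => hDB.
  have := ler_wpM2l (normr_ge0 t) hDB; rewrite -normrM mulrBr ler_norml => /andP[d1 d2].
  have /andP[h1 h2] := near_optimal_h a01 oB.
  have /andP[h3 h4] := near_optimal_h at0 oB.
  have := lsum_taylor a1 at1 taylor mu_ uC2 fB tk.
  have /andP[_ h5] := lsum1_near_optimal oB.
  have h6 : K * t ^+ 2 * lsum one B <= K * t ^+ 2 * (mu + 1).
    apply: ler_wpM2l; first by rewrite mulr_ge0 ?sqr_ge0.
    by rewrite (le_trans (ltW h5))// lerD2l.
  rewrite !ler_norml => /andP[h7 h8]; rewrite /W in We.
  have We' : phi (a + t) C * e + phi a C * e + `|t| * (3 * M * e) <= e'.
    by apply: le_trans We; rewrite le_eqVlt; apply/orP; left; apply/eqP; ring.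
  have d0 : 0 <= `|t| * (3 * M * e).
    by apply: mulr_ge0 => //; apply: mulr_ge0; [exact: mulr_ge0 | exact: ltW].
  have p1 : 0 <= phi (a + t) C * e by apply: mulr_ge0; [exact: powR_ge0 | exact: ltW].
  have p0 : 0 <= phi a C * e by apply: mulr_ge0; [exact: powR_ge0 | exact: ltW].
  move: h1 h2 h3 h4 d1 d2 h6 h7 h8 We' d0 p1 p0.
  move: (h _) (h _) (lsum _ _) (lsum _ _) (t * lsum _ _) (t * D) (K * _ * _)
    (K * _ * _) (phi _ _ * _) (phi _ _ * _) (`|t| * _) => *.
  by apply/andP; split; lra.
exists D; split.
  exists k, (K * (mu + 1)); split => // t /expand.
  by rewrite [K * (mu + 1) * _]mulrAC.
move=> eta eta0.
have mu0 : 0 <= mu + 1.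
  have [B oB] := near_optimal_ex ltr01; have fB := near_optimal_finite oB.
  have /andP[_ /ltW] := lsum1_near_optimal oB; apply: le_trans.
  by apply: le_trans (psum_le_lsum 0 bone one0 fB); rewrite psum_ge0.
(* The quadratic error enters twice: from the expansion of [h] and from that of the cost for [y].
   First [t] is fixed so that [W * t <= eta / 2], then [e] is taken at most [t * (eta / 2)]. *)
pose W := 2 * K * (mu + 1).
have W0 : 0 <= W by rewrite !mulr_ge0.
pose t : R := Num.min k (eta / 2 / (W + 1)).
have t0 : 0 < t by rewrite /t lt_min k_gt0 !divr_gt0// ltr_pwDr.
have tk : `|t| <= k by rewrite gtr0_norm// /t ge_min lexx.
have tk' : `|- t| <= k by rewrite normrN.
have Wt : W * t <= eta / 2.
  apply: (@le_trans _ _ ((W + 1) * t)); first by rewrite ler_wpM2r ?ltW// ltrDl.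
  by rewrite mulrC -ler_pdivlMr ?ltr_pwDr// /t ge_min lexx orbT.
exists (Num.min 1 (t * (eta / 2))).
  by rewrite lt_min ltr01 mulr_gt0// divr_gt0.
move=> e B /andP[e0]; rewrite le_min => /andP[e1 et] oB hB.
have fB := near_optimal_finite oB; have [cB _] := oB.
have hB' : lsum (fun x => phi a (y x)) B <= h a + e.
  by apply: lsum_le => //; exact: byp.
set J := lsum _ B.
(* The cover competes at exponent [a + t'], so its cost there is at least [h (a + t')], while at [a]
   it is at most [h a + e]. Expanding both sides gives the bound; increments of either sign then
   enclose [J - D]. *)
have one_side t' : `|t'| <= k -> - e - W * t' ^+ 2 <= t' * (J - D).
  move=> t'k; have at0 := at01 _ t'k; have /andP[at0' at1] := at0.
  have h1 : h (a + t') <= lsum (fun x => phi (a + t') (y x)) B.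
    apply: h_lb cB _ => // N; apply: psum_le_lsum => //; first exact: byp.
    by move=> x; exact: powR_ge0.
  have := lsum_taylor a1 at1 taylor my yC2 fB t'k.
  have /andP[_ h5] := lsum1_near_optimal oB.
  have h6 : K * t' ^+ 2 * lsum one B <= K * t' ^+ 2 * (mu + 1).
    apply: ler_wpM2l; first by rewrite mulr_ge0 ?sqr_ge0.
    by rewrite (le_trans (ltW h5))// lerD2l.
  have := expand _ t'k.
  rewrite !ler_norml -/J => /andP[h7 _] /andP[_ h8].
  have -> : W * t' ^+ 2 = 2 * (K * t' ^+ 2 * (mu + 1)) by rewrite /W; ring.
  rewrite mulrBr; move: h1 h6 h7 h8 hB'.
  move: (h _) (h _) (lsum _ _) (lsum _ _) (K * _ * _) (K * _ * _) (t' * _) (t' * _).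
  by move=> *; lra.
have s1 := one_side _ tk; have s2 := one_side _ tk'.
have Wt2 : W * t ^+ 2 <= t * (eta / 2).
  by rewrite expr2 mulrA [leRHS]mulrC ler_wpM2r// ltW.
rewrite sqrrN in s2.
rewrite ler_norml; apply/andP; split.
  by rewrite -(ler_pM2l t0); lra.
by rewrite -(ler_pM2l t0); lra.
Qed.

End near_optimal_covers.

(** * Passage from phi0 to Lambda *)

Lemma measurable_lne (R : realType) : measurable_fun setT (@lne R).
Proof.
rewrite (_ : @lne R = fun x => if x == +oo%E then +oo%E else
    if (x <= 0%:E)%E then -oo%E else (ln (fine x))%:E); last first.
  by apply/funext => -[r| |] //=; rewrite ?lee_fin// leNye.
apply: measurable_fun_ifT => //=; first exact: measurable_fun_eqe.
apply: measurable_fun_ifT => //=; first exact: measurable_fun_lee.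
apply/measurable_EFinP.
apply: (measurableT_comp (@measurable_ln R)).
exact: (@fine_measurable R setT).
Qed.

Section truncated_inverse_density.
Context d (T : measurableType d) (R : realType).
Variables (phi0 L : {finite_measure set T -> \bar R}) (Z : T -> \bar R).
Hypotheses (Lphi0 : L `<< phi0) (Z_ge0 : forall x, (0 <= Z x)%E)
  (mZ : measurable_fun setT Z)
  (dL : forall A, measurable A -> L A = (\int[phi0]_(x in A) Z x)%E).

Lemma density_integrable : phi0.-integrable setT Z.
Proof.
apply/integrableP; split => //.
under eq_integral do rewrite gee0_abs//.
by rewrite -dL// -ge0_fin_numE// fin_num_measure.
Qed.

(** [Z] agrees [phi0]-almost everywhere with the Radon-Nikodym derivative, having the same integrals
    over all measurable sets. *)
Lemma integral_density f A : bounded_mfun f -> measurable A ->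
  (\int[phi0]_(x in A) ((f x)%:E * Z x) = \int[L]_(x in A) (f x)%:E)%E.
Proof.
move=> bf mA; have [mf _] := bf.
rewrite -(Radon_Nikodym_change_of_variables Lphi0)//; last first.
  exact: bounded_mfun_integrable.
have mE : measurable_fun A (EFin \o f) by exact/measurable_funTS/measurable_EFinP.
have mRN : measurable_fun setT (Radon_Nikodym (charge_of_finite_measure L) phi0).
  exact: (measurable_int phi0 (Radon_Nikodym_integrable (Lphi0 : charge_of_finite_measure L `<< phi0))).
apply: ae_eq_integral => //.
- by apply: emeasurable_funM => //; exact: measurable_funTS.
- by apply: emeasurable_funM => //; exact: measurable_funTS.
apply: ae_eqe_mul2l.
apply: (ae_eq_subset (@subsetT _ A)).
apply: integral_ae_eq => //; first exact: density_integrable.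
by move=> B _ mB; rewrite -dL// -(@Radon_Nikodym_integral _ _ _ (charge_of_finite_measure L)).
Qed.

Variable c : R.
Hypotheses (c_gt0 : 0 < c) (Zc : {ae L, forall x, (c%:E <= Z x)%E}).

(** The bound holds only [Lambda]-almost everywhere. But [Z] has integral [Lambda [set x | Z x < c]
    = 0] over the exceptional set, hence vanishes there [phi0]-almost everywhere; integrability
    makes it finite elsewhere. *)
Lemma density_dichotomy : {ae phi0, forall x, Z x = 0 \/ (c%:E <= Z x < +oo)%E}.
Proof.
have mD : measurable [set x | (Z x < c%:E)%E].
  by rewrite -[X in measurable X]setTI; exact: emeasurable_fun_infty_o.
have Zfin := integrable_ae measurableT density_integrable.
have L0 : L [set x | (Z x < c%:E)%E] = 0%E.
  case: Zc => N [mN N0 ZN]; apply: (subset_measure0 mD mN) => // x /= Zx.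
  by apply: ZN => /=; apply/negP; rewrite -ltNge.
have : ae_eq phi0 [set x | (Z x < c%:E)%E] Z (cst 0%E).
  apply/(ae_eq_integral_abs _ mD); first exact: measurable_funTS.
  by under eq_integral do rewrite gee0_abs//; rewrite -dL.
move: Zfin; apply: filterS2 => x /(_ I) Zfin Z0.
have [/Z0 ->|cZ] := ltP (Z x) c%:E; first by left.
by right; rewrite -ge0_fin_numE.
Qed.

(* This is [1 / Z] on [c <= Z < +oo], a set which carries [L]; elsewhere only the
   bound by [1 / c] matters ([fine +oo = 0]). *)
Definition inv_density x : R := Num.max c (fine (Z x)) `^ (-1).

Lemma measurable_inv_density : measurable_fun setT inv_density.
Proof.
apply: (measurableT_comp (measurable_powR (-1))).
apply: measurable_maxr => //.
exact: (measurableT_comp (@fine_measurable R setT measurableT) mZ).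
Qed.

Lemma inv_density_ge0 x : 0 <= inv_density x.
Proof. exact: powR_ge0. Qed.

Lemma inv_density_le x : inv_density x <= c^-1.
Proof.
have m0 : 0 < Num.max c (fine (Z x)) by rewrite lt_max c_gt0.
by rewrite /inv_density (powR_inv1 (ltW m0)) lef_pV2 ?posrE// le_max lexx.
Qed.

Lemma powR_compl_inv_density a x : 0 < a < 1 ->
  Z x = 0 \/ (c%:E <= Z x < +oo)%E ->
  (Z x `^ a = (powR_compl a (inv_density x))%:E * Z x)%E.
Proof.
move=> /andP[a0 a1] [->|/andP[]]; first by rewrite mule0 poweR0r ?gt_eqF.
rewrite /inv_density /powR_compl; case: (Z x) => //= z; rewrite lee_fin => cz _.
have z0 : 0 < z by exact: lt_le_trans cz.
rewrite (max_idPr cz) -EFinM; congr EFin.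
rewrite -powRrM -[in RHS](powRr1 (ltW z0)) -powRrM.
rewrite -powRD; last by rewrite (gt_eqF z0) implybT.
by congr powR; ring.
Qed.

(** Since [inv_density] is [1 / Z] where [Z] is positive and finite, its logarithm is minus that of
    [Z], which cancels the sign in [dpowR_compl]. *)
Lemma dpowR_compl_inv_density a x : 0 < a < 1 ->
  Z x = 0 \/ (c%:E <= Z x < +oo)%E ->
  (Z x `^ a * lne (Z x) = (dpowR_compl a (inv_density x))%:E * Z x)%E.
Proof.
move=> a01 hZ; have := powR_compl_inv_density a01 hZ => ->.
have /andP[a0 a1] := a01; case: hZ => [->|/andP[]]; first by rewrite !mule0 mul0e.
rewrite /inv_density /powR_compl /dpowR_compl.
case: (Z x) => //= z; rewrite lee_fin => cz _.
have z0 : 0 < z by exact: lt_le_trans cz.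
rewrite (max_idPr cz) leNgt z0/= -!EFinM ln_powR; congr EFin; ring.
Qed.

Lemma bounded_powR_compl_inv_density a : a < 1 ->
  bounded_mfun (fun x => powR_compl a (inv_density x)).
Proof.
move=> a1; apply: (bounded_mfun_powR (C := c^-1)) => [||x]; first by lra.
  exact: measurable_inv_density.
by rewrite inv_density_ge0 inv_density_le.
Qed.

Lemma bounded_dpowR_compl_inv_density a : a < 1 ->
  bounded_mfun (fun x => dpowR_compl a (inv_density x)).
Proof.
move=> a1; apply: (bounded_mfun_dphi (C := c^-1)) => // [||x].
- by rewrite invr_gt0.
- exact: measurable_inv_density.
- by rewrite inv_density_ge0 inv_density_le.
Qed.

Lemma integral_powR_density a A : 0 < a < 1 -> measurable A ->
  (\int[phi0]_(x in A) (Z x `^ a) =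
   (lam L (fun x => powR_compl a (inv_density x)) A)%:E)%E.
Proof.
move=> a01 mA; have /andP[a0 a1] := a01.
have bf := bounded_powR_compl_inv_density a1; have [mf _] := bf.
rewrite lamE// -integral_density//; apply: ae_eq_integral => //.
- apply: measurable_funTS; exact: (measurableT_comp (measurable_poweR a) mZ).
- by apply: measurable_funTS; apply: emeasurable_funM => //; exact/measurable_EFinP.
have := density_dichotomy; apply: filterS => x hx _ /=.
exact: powR_compl_inv_density.
Qed.

Lemma integral_powR_lne_density a A : 0 < a < 1 -> measurable A ->
  (\int[phi0]_(x in A) (Z x `^ a * lne (Z x)) =
   (lam L (fun x => dpowR_compl a (inv_density x)) A)%:E)%E.
Proof.
move=> a01 mA; have /andP[a0 a1] := a01.
have bf := bounded_dpowR_compl_inv_density a1; have [mf _] := bf.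
rewrite lamE// -integral_density//; apply: ae_eq_integral => //.
- apply: measurable_funTS; apply: emeasurable_funM.
    exact: (measurableT_comp (measurable_poweR a) mZ).
  exact: (measurableT_comp (@measurable_lne R) mZ).
- by apply: measurable_funTS; apply: emeasurable_funM => //; exact/measurable_EFinP.
have := density_dichotomy; apply: filterS => x hx _ /=.
exact: dpowR_compl_inv_density.
Qed.

End truncated_inverse_density.

(** * Extended-real series of costs as limits of real partial sums *)

Section series_of_costs.
Context d (T : measurableType d) (R : realType).
Variables (L : {finite_measure set T -> \bar R}).
Implicit Types (f : T -> R) (B : nat -> set T).

Lemma sum_lamE f B N : (\sum_(0 <= n < N) (lam L f (B n))%:E)%E = (psum L f B N)%:E.
Proof. by rewrite sumEFin. Qed.

Lemma nneseries_lam_le f B r : (forall x, 0 <= f x) ->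
  (\sum_(n <oo) (lam L f (B n))%:E <= r%:E)%E <-> forall N, psum L f B N <= r.
Proof.
move=> f0; have lam0 n : (0 <= (lam L f (B n))%:E)%E by rewrite lee_fin lam_ge0.
split=> [h N|h].
  rewrite -lee_fin -sum_lamE; apply: le_trans h.
  exact: nneseries_lim_ge.
apply: lime_le; first exact: is_cvg_nneseries.
by near=> N; rewrite sum_lamE lee_fin.
Unshelve. all: by end_near. Qed.

Lemma eseries_lam f B : bounded_mfun f -> finite_cost L B ->
  (\sum_(n <oo) (lam L f (B n))%:E = (lsum L f B)%:E)%E.
Proof.
move=> bf fB; rewrite -EFin_lim; last exact: cvg_psum.
by congr (limn _); apply/funext => N; rewrite sum_lamE.
Qed.

End series_of_costs.

(** * Differentiability of calH *)

(** Division by [t] leaves an error of order [|t|]. The filter is arbitrary so that one-sided and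
    two-sided limits are treated at once. *)
Lemma cvg_difference_quotient (R : realType) (h : R -> R) (a D k K : R)
    (F : set_system R) {FF : Filter F} : 0 < k ->
  (forall t, `|t| <= k -> `|h (a + t) - h a - t * D| <= K * t ^+ 2) ->
  (\forall t \near F, t != 0) -> (forall e, 0 < e -> \forall t \near F, `|t| <= e) ->
  (h (a + t) - h a) / t @[t --> F] --> D.
Proof.
move=> k0 hK Fn0 F0; apply/cvgrPdist_le => e e0.
have K0 : 0 < `|K| + 1 by rewrite ltr_wpDl.
near=> t.
have t0 : t != 0 by near: t.
have tk : `|t| <= k by near: t; exact: F0.
have te : `|t| <= e / (`|K| + 1) by near: t; apply: F0; rewrite divr_gt0.
have nt0 : 0 < `|t| by rewrite normr_gt0.
rewrite distrC -(ler_pM2r nt0) -normrM mulrBl divfK// [D * t]mulrC.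
apply: le_trans (hK t tk) _; rewrite -real_normK ?num_real// expr2 mulrA.
rewrite ler_wpM2r//; move: te; rewrite ler_pdivlMr// => te.
apply: le_trans te; rewrite mulrC ler_wpM2l//.
by rewrite (le_trans (ler_norm K))// lerDl.
Unshelve. all: by end_near. Qed.

Lemma cvg_fin_bounds (R : realType) (T : Type) (F : set_system T) {FF : Filter F}
    (f : T -> \bar R) (D : R) :
  (forall eta, 0 < eta -> \forall t \near F,
     ((D - eta)%:E <= f t <= (D + eta)%:E)%E) ->
  f t @[t --> F] --> D%:E.
Proof.
move=> fD; apply/fine_cvgP; split.
  have := fD _ ltr01; apply: filterS => t /andP[h1 h2].
  by rewrite fin_numE; case: (f t) h1 h2.
apply/cvgrPdist_le => e e0; have := fD _ e0; apply: filterS => t /andP[] /=.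
case: (f t) => //= r; rewrite !lee_fin => h1 h2.
by rewrite distrC ler_norml; apply/andP; split; lra.
Qed.

(** * Correspondence between covers by sets of [A_neg] and their preimages *)

Section shift_covers.
Context {X : pointedType} {R : realType}.
Variables (S Si : X -> X) (cA : set (set X)) (Q : set X).
Hypotheses (SK : cancel S Si) (SiK : cancel Si S).
Local Notation T := (A0_type S cA).

Lemma measurable_shift : measurable_fun setT (S : T -> T).
Proof.
apply: (measurability _ (erefl : @measurable _ T = <<s forward_gen S cA >>)).
move=> _ [_ [i _ [A cAA <-]] <-]; rewrite setTI.
apply: sub_gen_smallest; exists i.+1 => //; exists A => //.
by apply/funext => x; rewrite /preimage/= -iterSr.
Qed.

Lemma iter_shiftK n : cancel (iter n S) (iter n Si).
Proof. by move=> x; elim: n => // n IH; rewrite iterSr /= SK. Qed.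

Lemma iter_invK n : cancel (iter n Si) (iter n S).
Proof. by move=> x; elim: n => // n IH; rewrite iterSr /= SiK. Qed.

Lemma preimage_image_iter n (B : set X) : iter n S @^-1` (iter n S @` B) = B.
Proof.
apply/seteqP; split => [x [z Bz]|x Bx]; last by exists x.
by move/(can_inj (iter_shiftK n)) => <-.
Qed.

Lemma Ccover_is_cover (A : nat -> set X) : Ccover S cA Q A ->
  is_cover (T := T) Si Q (fun n => iter n S @^-1` A n).
Proof.
move=> [AA QA]; split=> [n|x /QA[n _ Anx]].
  by have [B mB <-] := AA n; rewrite preimage_image_iter.
by exists n; rewrite /= iter_invK.
Qed.

Lemma is_cover_Ccover (B : nat -> set T) : is_cover (T := T) Si Q B ->
  exists2 A, Ccover S cA Q A & forall n, iter n S @^-1` A n = B n.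
Proof.
move=> [mB QB]; exists (fun n => iter n S @` B n); last first.
  by move=> n; exact: preimage_image_iter.
split=> [n|x /QB[n Bn]]; first by exists (B n) => //; exact: mB.
by exists n => //; exists (iter n Si x) => //; exact: iter_invK.
Qed.

Variable L : {finite_measure set T -> \bar R}.
Variables (c : set X -> \bar R) (g : T -> R).
Hypothesis g_ge0 : forall x, 0 <= g x.
Hypothesis cg : forall B : set T, measurable B -> c B = (lam L g B)%:E.

Local Notation cost_inf := (ereal_inf [set cover_sum S c A | A in Ccover S cA Q]).

Lemma cover_sum_lam (A : nat -> set X) : Ccover S cA Q A ->
  cover_sum S c A = (\sum_(n <oo) (lam L g (iter n S @^-1` A n))%:E)%E.
Proof.
move=> /Ccover_is_cover[mB _]; rewrite /cover_sum; apply: eq_eseriesr => n _.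
exact: cg.
Qed.

Lemma cover_sum_lam_le (A : nat -> set X) r : Ccover S cA Q A ->
  (cover_sum S c A <= r%:E)%E <->
  forall N, psum L g (fun n => iter n S @^-1` A n) N <= r.
Proof. by move=> cAA; rewrite (cover_sum_lam cAA); exact: nneseries_lam_le. Qed.

Lemma cover_sum_ge0 (A : nat -> set X) : Ccover S cA Q A -> (0 <= cover_sum S c A)%E.
Proof.
move=> cAA; rewrite (cover_sum_lam cAA); apply: nneseries_ge0 => n _ _.
by rewrite lee_fin lam_ge0.
Qed.

Lemma cover_sum_lam_lt (A : nat -> set X) r : Ccover S cA Q A ->
  (cover_sum S c A < r%:E)%E <->
  exists2 s, s < r & forall N, psum L g (fun n => iter n S @^-1` A n) N <= s.
Proof.
move=> cAA; split=> [h|[s sr /(cover_sum_lam_le _ cAA) h]]; last first.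
  by apply: le_lt_trans h _; rewrite lte_fin.
have fin : cover_sum S c A \is a fin_num.
  by rewrite ge0_fin_numE ?cover_sum_ge0// (lt_trans h)// ltry.
exists (fine (cover_sum S c A)); first by rewrite -lte_fin fineK.
by apply/(cover_sum_lam_le _ cAA); rewrite fineK.
Qed.

Lemma cost_inf_fin_num : cost_inf \is a fin_num.
Proof.
rewrite ge0_fin_numE; last first.
  by apply: le_ereal_inf_tmp => _ [A cAA <-]; exact: cover_sum_ge0.
(* The whole space at level 0 is a cover of finite cost. *)
pose B n : set T := if n is 0%N then setT else set0.
have cB : is_cover (T := T) Si Q B.
  split => [n|x _]; last by exists 0%N.
  by case: n => [|n]; [exact: measurableT | exact: measurable0].
have [A cAA AB] := is_cover_Ccover cB.
apply: (@le_lt_trans _ _ (lam L g setT)%:E); last exact: ltry.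
apply: ge_ereal_inf; exists (cover_sum S c A); first by exists A.
apply/(cover_sum_lam_le _ cAA) => N; under eq_fun do rewrite AB.
case: N => [|N]; first by rewrite /psum big_nil lam_ge0.
rewrite /psum big_nat_recl//= big1 ?addr0// => n _.
by rewrite /lam Rintegral_set0.
Qed.

Lemma cost_inf_le (B : nat -> set T) r : is_cover (T := T) Si Q B ->
  (forall N, psum L g B N <= r) -> fine cost_inf <= r.
Proof.
move=> cB hB; have [A cAA AB] := is_cover_Ccover cB.
rewrite -lee_fin fineK ?cost_inf_fin_num//.
apply: ge_ereal_inf; exists (cover_sum S c A); first by exists A.
by apply/(cover_sum_lam_le _ cAA) => N; under eq_fun do rewrite AB.
Qed.

Lemma cost_inf_adherent e : 0 < e -> exists B : nat -> set T,
  is_cover (T := T) Si Q B /\ exists2 r, r < fine cost_inf + e & forall N, psum L g B N <= r.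
Proof.
move=> e0; have [_ [A cAA <-]] := lb_ereal_inf_adherent e0 cost_inf_fin_num.
rewrite -(fineK cost_inf_fin_num) -EFinD => /(cover_sum_lam_lt _ cAA) h.
by exists (fun n => iter n S @^-1` A n); split => //; exact: Ccover_is_cover.
Qed.

End shift_covers.

(** * Expansion of [calH] and identification of [calD1] and [calE1] *)

Section invariant_density_entropy.
Context {X : pointedType} {R : realType} (S Si : X -> X) (cA : set (set X)).
Local Notation T := (A0_type S cA).
Variables (phi0 Lambda : {finite_measure set T -> \bar R}) (Z : T -> \bar R).
Variables (Q : set X) (c : R).
Hypotheses (SK : cancel S Si) (SiK : cancel Si S).
Hypothesis invLambda : forall A : set T, measurable A ->
  Lambda (S @^-1` A) = Lambda A.
Hypotheses (Lambda_phi0 : Lambda `<< phi0) (Z_ge0 : forall x, (0 <= Z x)%E)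
  (mZ : measurable_fun setT Z).
Hypothesis dLambda : forall A : set T, measurable A ->
  Lambda A = (\int[phi0]_(x in A) Z x)%E.
Hypotheses (c_gt0 : 0 < c) (Zc : {ae Lambda, forall x, (c%:E <= Z x)%E}).

Local Notation one := (cst (1 : R) : T -> R).
Local Notation y := (inv_density Z c).
Local Notation pull A := (fun n => iter n S @^-1` A n).
Local Notation h := (fun a => fine (calH phi0 Z a Q)).
Local Notation mu := (fine (outer_Lambda Lambda Q)).
Local Notation optimal := (near_optimal Lambda Si Q mu).

Let mS : measurable_fun setT (S : T -> T). Proof. exact: measurable_shift. Qed.
Let my : measurable_fun setT y. Proof. exact: measurable_inv_density. Qed.
Let y0 x : 0 <= y x. Proof. exact: inv_density_ge0. Qed.
Let yC x : y x <= c^-1. Proof. exact: inv_density_le. Qed.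
Let C0 : 0 < c^-1. Proof. by rewrite invr_gt0. Qed.

Let bone : bounded_mfun one. Proof. exact: bounded_mfun_cst. Qed.
Let one0 x : 0 <= one x. Proof. exact: ler01. Qed.
Let Lone (B : set T) : measurable B -> Lambda B = (lam Lambda one B)%:E.
Proof. by move=> mB; rewrite lam1. Qed.

Let py0 a x : 0 <= powR_compl a (y x). Proof. exact: powR_ge0. Qed.
Let int_powE a (B : set T) : 0 < a < 1 -> measurable B ->
  int_pow phi0 Z a B = (lam Lambda (fun x => powR_compl a (y x)) B)%:E.
Proof. by move=> a01 mB; exact: integral_powR_density. Qed.

Lemma calH_fin_num a : 0 < a < 1 -> calH phi0 Z a Q \is a fin_num.
Proof.
move=> a01.
exact: (cost_inf_fin_num Q SK SiK (py0 a) (fun B => int_powE a01)).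
Qed.

Lemma outer_Lambda_fin_num : outer_Lambda Lambda Q \is a fin_num.
Proof. exact: (cost_inf_fin_num Q SK SiK one0 Lone). Qed.

Let mu_lb (B : nat -> set T) r : is_cover (T := T) Si Q B ->
  (forall N, psum Lambda one B N <= r) -> mu <= r.
Proof. exact: (cost_inf_le SK SiK one0 Lone). Qed.

Let optimal_ex (e : R) : 0 < e -> exists B : nat -> set T, optimal e B.
Proof. exact: (cost_inf_adherent Q SK SiK one0 Lone). Qed.

Let h_lb a (B : nat -> set T) r : 0 < a < 1 -> is_cover (T := T) Si Q B ->
  (forall N, psum Lambda (fun x => powR_compl a (y x)) B N <= r) -> h a <= r.
Proof.
move=> a01.
exact: (cost_inf_le SK SiK (py0 a) (fun B => int_powE a01)).
Qed.

Let h_ex (a e : R) : 0 < a < 1 -> 0 < e -> exists2 B : nat -> set T,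
  is_cover (T := T) Si Q B &
  forall N, psum Lambda (fun x => powR_compl a (y x)) B N <= h a + e.
Proof.
move=> a01 e0; have [B [cB [r re hr]]] :=
  cost_inf_adherent Q SK SiK (py0 a) (fun B => int_powE a01) e0.
by exists B => // N; exact: le_trans (hr N) (ltW re).
Qed.

Lemma Ccover1P (e : R) A : Ccover1 Lambda e Q A <->
  Ccover S cA Q A /\ optimal e (pull A).
Proof.
rewrite /Ccover1 /= -(fineK outer_Lambda_fin_num) -EFinD.
split=> -[cAA hA]; split => //.
  split; first exact: (Ccover_is_cover SK SiK).
  by apply/(cover_sum_lam_lt SK SiK one0 Lone _ cAA).
by apply/(cover_sum_lam_lt SK SiK one0 Lone _ cAA); case: hA.
Qed.

Lemma optimal_both (a e : R) : 0 < a < 1 -> 0 < e -> exists A,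
  [/\ Ccover1 Lambda e Q A &
      (cover_sum S (int_pow phi0 Z a) A <= (h a + e)%:E)%E].
Proof.
move=> a01 e0.
have [B oB hB] := near_optimal_both mS SiK invLambda my y0 yC mu_lb optimal_ex
  h_lb h_ex a01 e0.
have [A cAA AB] := is_cover_Ccover SK SiK (proj1 oB).
have eAB : pull A = B by apply/funext.
exists A; split; first by apply/Ccover1P; rewrite eAB.
by apply/(cover_sum_lam_le SK SiK (py0 a) (fun B => int_powE a01) _ cAA);
  rewrite eAB.
Qed.

(** Requiring near optimality for [Lambda] does not raise the infimum, since some covers are nearly
    optimal for both costs; the expression under the limit is therefore constant for [e > 0]. *)
Lemma calH1E a : 0 < a < 1 -> calH1 phi0 Lambda Z a Q = (h a)%:E.
Proof.
move=> a01; apply/cvg_lim => //; apply: cvg_near_cst.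
near=> e; have e0 : 0 < e by near: e; exact: nbhs_right_gt.
apply/eqP; rewrite eq_le; apply/andP; split; last first.
  rewrite fineK ?calH_fin_num//; apply: le_ereal_inf_tmp => _ [A [cAA _] <-].
  by apply: ereal_inf_lbound; exists A.
apply/lee_addgt0Pr => e' e'0.
have m0 : 0 < Num.min e e' by rewrite lt_min e0.
have [A [oA hA]] := optimal_both a01 m0.
apply: ge_ereal_inf; exists (cover_sum S (int_pow phi0 Z a) A).
  exists A => //; move: oA => /Ccover1P[cAA oA]; apply/Ccover1P; split => //.
  by apply: near_optimal_le oA; rewrite ge_min lexx.
by apply: le_trans hA _; rewrite -EFinD lee_fin lerD2l ge_min lexx orbT.
Unshelve. all: by end_near. Qed.

Lemma calH_expansion a : 0 < a < 1 -> exists D : R,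
  [/\ exists k K : R, 0 < k /\ forall t, `|t| <= k ->
        `|h (a + t) - h a - t * D| <= K * t ^+ 2,
      calD1 phi0 Lambda Z a a Q = D%:E & calE1 phi0 Lambda Z a a Q = D%:E].
Proof.
move=> a01; have /andP[a0 a1] := a01.
have [D [hD approx]] := h_expansion mS SiK invLambda my y0 C0 yC mu_lb
  optimal_ex h_lb h_ex a01.
have bd := bounded_dpowR_compl_inv_density mZ c_gt0 a1.
(* Nonemptiness matters too: over an empty family the infimum would be [+oo] and the supremum
   [-oo]. *)
have values eta : 0 < eta -> \forall e \near (0 : R)^'+,
    (exists A, Ccoverb1 phi0 Lambda Z a e Q A) /\
    forall A, Ccoverb1 phi0 Lambda Z a e Q A ->
      ((D - eta)%:E <= cover_sum S (int_pow_log phi0 Z a) A <= (D + eta)%:E)%E.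
  move=> /approx[e1 e10 he1]; near=> e.
  have e0 : 0 < e by near: e; exact: nbhs_right_gt.
  have ee1 : e <= e1 by near: e; exact: nbhs_right_le.
  split.
    (* Half of [e] yields the strict inequality demanded by [Ccoverb1]. *)
    have e20 : 0 < e / 2 by rewrite divr_gt0.
    have [A [oA hA]] := optimal_both a01 e20; exists A; split.
      move: oA => /Ccover1P[cAA oA]; apply/Ccover1P; split => //.
      by apply: near_optimal_le oA; lra.
    rewrite calH1E// -EFinD; apply: le_lt_trans hA _; rewrite lte_fin; lra.
  move=> A [/Ccover1P[cAA oA]]; rewrite calH1E// -EFinD => /ltW.
  move=> /(cover_sum_lam_le SK SiK (py0 a) (fun B => int_powE a01) _ cAA) hA.
  have e01 : 0 < e <= e1 by rewrite e0.
  have fA := near_optimal_finite oA; have [mA _] := fA.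
  have -> : cover_sum S (int_pow_log phi0 Z a) A =
      (lsum Lambda (fun x => dpowR_compl a (y x)) (pull A))%:E.
    rewrite -eseries_lam//; apply: eq_eseriesr => n _.
    exact: integral_powR_lne_density.
  have := he1 e _ e01 oA hA; rewrite !lee_fin ler_norml => /andP[? ?].
  by apply/andP; split; lra.
exists D; split => //; apply/cvg_lim => //; apply: cvg_fin_bounds => eta eta0;
  have := values _ eta0; apply: filterS => e [[A oA] hA]; have /andP[A1 A2] := hA _ oA.
- apply/andP; split.
    by apply: le_ereal_inf_tmp => _ [B oB <-]; case/andP: (hA _ oB).
  by apply: ge_ereal_inf; exists (cover_sum S (int_pow_log phi0 Z a) A) => //; exists A.
- apply/andP; split.
    by apply: le_trans A1 _; apply: ereal_sup_ubound; exists A.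
  by apply: ge_ereal_sup => _ [B oB <-]; case/andP: (hA _ oB).
Unshelve. all: by end_near. Qed.

End invariant_density_entropy.

Local Open Scope ereal_scope.

Theorem corollary4 (R : realType) (X : pointedType) (S : X -> X)
  (cA : set (set X))
  (phi0 Lambda : {finite_measure set (A0_type S cA) -> \bar R})
  (Z : A0_type S cA -> \bar R) (Q : set X)
  (bijS : bijective S)
  (sigma_cA : sigma_algebra setT cA)
  (invLambda : forall A : set (A0_type S cA), measurable A ->
     Lambda (S @^-1` A) = Lambda A)
  (Lambda_phi0 : Lambda `<< phi0)
  (Z_ge0 : forall x, 0 <= Z x)
  (mZ : measurable_fun setT Z)
  (dLambda : forall A : set (A0_type S cA), measurable A ->
     Lambda A = \int[phi0]_(x in A) Z x)
  (QB : <<s twosided_gen S cA >> Q)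
  (Zc : essentially_bounded_away_from_zero Lambda Z) :
  let H := fun x : R => calH phi0 Z x Q in
  let h := fun x : R => fine (H x) in
  [/\ forall x : R, (0 < x < 1)%R -> H x \is a fin_num,
      forall x : R, (0 < x < 1)%R ->
        left_differentiable h x /\ right_differentiable h x
    & countable [set a : R | (0 < a < 1)%R /\
        ~ [/\ derivable h a 1%R,
              ((h^`())%classic a)%:E = calD1 phi0 Lambda Z a a Q
            & calD1 phi0 Lambda Z a a Q = calE1 phi0 Lambda Z a a Q]]].
Proof.
move: bijS Zc => [Si SK SiK] [c c0 Zc'] H h.
have dquot (a : R) (a01 : (0 < a < 1)%R) : exists D : R,
    [/\ exists k K : R, (0 < k)%R /\ forall t, (`|t| <= k)%R ->
          (`|h (a + t) - h a - t * D| <= K * t ^+ 2)%R,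
        calD1 phi0 Lambda Z a a Q = D%:E & calE1 phi0 Lambda Z a a Q = D%:E].
  exact: (calH_expansion Q SK SiK invLambda Lambda_phi0 Z_ge0 mZ dLambda c0 Zc').
split.
- move=> x x01.
  exact: (calH_fin_num Q SK SiK Lambda_phi0 Z_ge0 mZ dLambda c0 Zc').
- move=> x x01; have [D [[k [K [k0 hK]]] _ _]] := dquot x x01.
  split; apply/cvg_ex; exists D; apply: (cvg_difference_quotient k0 hK).
  + by near=> t; rewrite lt_eqF//; near: t; exact: nbhs_left_lt.
  + move=> e e0; near=> t.
    have t0 : (t < 0)%R by near: t; exact: nbhs_left_lt.
    rewrite ltr0_norm// lerNl; near: t; apply: nbhs_left_ge.
    by rewrite oppr_lt0.
  + by near=> t; rewrite gt_eqF//; near: t; exact: nbhs_right_gt.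
  + move=> e e0; near=> t.
    have t0 : (0 < t)%R by near: t; exact: nbhs_right_gt.
    by rewrite gtr0_norm//; near: t; exact: nbhs_right_le.
(* The expansion holds at every point of (0,1), so no exceptional point exists. *)
- rewrite (_ : [set _ | _] = set0); first exact: countable0.
  apply/seteqP; split => // a [a01]; apply.
  have [D [[k [K [k0 hK]]] -> ->]] := dquot a a01.
  have hq : (t^-1 *: (h (t *: 1 + a) - h a) @[t --> 0^'] --> D)%R.
    rewrite (_ : (fun t => _) = (fun t => (h (a + t) - h a) / t)%R); last first.
      by apply/funext => t; rewrite /GRing.scale/= mulr1 mulrC [(t + a)%R]addrC.
    apply: (cvg_difference_quotient k0 hK).
      exact: nbhs_dnbhs_neq.
    move=> e e0; near=> t; near: t; apply: dnbhs0_le.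
    exact: e0.
  have hd : derivable h a 1%R by apply/cvg_ex; exists D.
  split => //; rewrite derive1E; congr EFin.
  exact/cvg_lim.
Unshelve. all: by end_near. Qed.
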